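(* Let $G$ be a path-connected, locally path-connected, semilocally simply-connected topological group with universal covering group $\tilde G$, and let $\Sigma_h$ be a closed (oriented) surface of genus $h\ge1$. Assume that there exist a homogeneous quasi-morphism $\mu\in Q(\tilde G)$ and an element $\gamma\in\pi_1(G)\subset\tilde G$ with $\mu(\gamma)\ne0$. Then there exist infinitely many isomorphism classes of principal $G$-bundles over $\Sigma_h$ which do not admit foliated $G$-bundle structures.
   Context: $Q(\tilde G)$ is the space of homogeneous quasi-morphisms on $\tilde G$: functions $\mu\colon\tilde G\to\mathbb R$ with $\sup_{g,h}|\mu(gh)-\mu(g)-\mu(h)|<\infty$ and $\mu(g^n)=n\mu(g)$ for all $g\in\tilde G$, $n\in\mathbb Z$. $\pi_1(G)$ is identified with the kernel of the universal covering $\tilde G\to G$. A principal $G$-bundle over $B$ admits a foliated (flat) structure if its classifying map $B\to BG$ factors, up to homotopy, through $B\iota\colon BG^\delta\to BG$, where $G^\delta$ is $G$ with the discrete topology and $\iota$ the identity; equivalently, if it is isomorphic to the bundle induced by some homomorphism $\pi_1(B)\to G$. *)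

(* Defs.v *)
From HB Require Import structures.
From Stdlib Require Import Relation_Operators.
From mathcomp Require Import all_boot all_order all_algebra generic_quotient.
From mathcomp Require Import all_classical all_reals all_analysis homotopy.
Set Implicit Arguments.
Unset Strict Implicit.
Unset Printing Implicit Defensive.
Import Order.TTheory GRing.Theory Num.Theory.
Import numFieldNormedType.Exports.
Local Open Scope classical_set_scope.
Local Open Scope ring_scope.
Local Open Scope quotient_scope.

HB.mixin Record Group_isTopologicalGroup G & Group G & Topological G := {
  mulg_continuous : continuous (fun xy : G * G => (xy.1 * xy.2)%g) ;
  invg_continuous : continuous (fun x : G => x^-1%g)
}.

#[short(type="topologicalGroupType")]
HB.structure Definition TopologicalGroup :=
  {G of Group G & Topological G & Group_isTopologicalGroup G}.

Section generated_equivalence.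
Context {T : choiceType} (r : T -> T -> Prop).

Definition gen_equiv : rel T :=
  fun x y => `[< clos_refl_sym_trans T r x y >].

Lemma gen_equiv_equiv : equiv_class_of gen_equiv.
Proof.
split=> [x|x y|y x z]; first by apply/asboolP; exact: rst_refl.
- by apply/asboolP/asboolP => xy; exact: rst_sym.
- by move=> /asboolP xy /asboolP yz; apply/asboolP; exact: rst_trans yz.
Qed.

Canonical gen_equiv_rel := EquivRelPack gen_equiv_equiv.

Definition quot_by := {eq_quot gen_equiv}.

HB.instance Definition _ := Choice.on quot_by.
HB.instance Definition _ := EqQuotient.on quot_by.

Lemma gen_equivP (x y : T) :
  \pi_quot_by x = \pi_quot_by y <-> clos_refl_sym_trans T r x y.
Proof.
split=> [/eqP|xy]; first by rewrite eqmodE => /asboolP.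
by apply/eqP; rewrite eqmodE; apply/asboolP.
Qed.

End generated_equivalence.
Arguments quot_by {T} r.

Section unit_interval.
Context (R : realType).

Definition I01 : Type := set_type (`[0%R, 1%R]%classic : set R).

HB.instance Definition _ := Topological.on I01.

Lemma clamp_subproof (t : R) :
  Num.max 0 (Num.min 1 t) \in (`[0%R, 1%R]%classic : set R).
Proof.
rewrite inE /= in_itv /= le_max lexx /= ge_max ler01 /=.
by rewrite ge_min lexx.
Qed.

Definition I01_val (t : I01) : R := sval t.

Definition clamp (t : R) : I01 :=
  exist (fun x => x \in (`[0%R, 1%R]%classic : set R)) _ (clamp_subproof t).

Lemma clamp01 : clamp 0 != clamp 1.
Proof.
apply/eqP => /(congr1 I01_val) /=.
rewrite minxx (min_idPr ler01) maxxx (max_idPr ler01) => /esym/eqP.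
by rewrite oner_eq0.
Qed.

HB.instance Definition _ := isBiPointed.Build I01 clamp01.

End unit_interval.


Section concatenation.
Context (R : realType) (T : topologicalType).
Implicit Types p q : I01 R -> T.

Lemma clamp_continuous : continuous (@clamp R).
Proof.
apply/continuousP => _ [B oB <-].
have -> : @clamp R @^-1` (set_val @^-1` B) =
    (fun t : R => Num.max 0 (Num.min 1 t)) @^-1` B by [].
have /continuousP : continuous (fun t : R => Num.max (0 : R) (Num.min 1 t)).
  move=> t; apply: (@continuous_max R R (cst (0 : R^o)) (fun t => Num.min 1 t)).
    exact: cst_continuous.
  apply: (@continuous_min R R (cst (1 : R^o)) id); first exact: cst_continuous.
  exact: cvg_id.
exact.
Qed.

Definition concat p q (t : I01 R) : T :=
  if I01_val t <= 2^-1 then p (clamp (2 * I01_val t))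
  else q (clamp (2 * I01_val t - 1)).

Lemma val_I01_continuous : continuous (@I01_val R).
Proof. exact: initial_continuous. Qed.

Lemma clamp_val (t : I01 R) : clamp (I01_val t) = t.
Proof.
apply/val_inj => /=; case: t => t /= /set_mem /=.
by rewrite in_itv /= => /andP[t0 t1]; rewrite (min_idPr t1) (max_idPr t0).
Qed.

Lemma val_clamp (t : R) : 0 <= t <= 1 -> I01_val (clamp t) = t.
Proof. by move=> /andP[t0 t1] /=; rewrite (min_idPr t1) (max_idPr t0). Qed.

Lemma clamp_le0 (t : R) : t <= 0 -> clamp t = zero.
Proof.
move=> t0; apply/val_inj => /=.
by rewrite (min_idPr (le_trans t0 ler01)) (max_idPl t0) (min_idPr ler01) maxxx.
Qed.

Lemma clamp_ge1 (t : R) : 1 <= t -> clamp t = one.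
Proof. by move=> t1; apply/val_inj => /=; rewrite (min_idPl t1) minxx. Qed.

Lemma concat_continuous p q : continuous p -> continuous q ->
  p one = q zero -> continuous (concat p q).
Proof.
move=> cp cq pq.
have c2 : continuous (fun t : I01 R => 2 * I01_val t).
  move=> t; apply: (@continuous_comp _ _ _ (@I01_val R) (fun x : R => 2 * x)).
    exact: val_I01_continuous.
  exact: mulrl_continuous.
have cp' : continuous (fun t : I01 R => p (clamp (2 * I01_val t))).
  move=> t; apply: (@continuous_comp _ _ _ (fun t => clamp (2 * I01_val t)) p).
    by apply: continuous_comp; [exact: c2|exact: clamp_continuous].
  exact: cp.
have cq' : continuous (fun t : I01 R => q (clamp (2 * I01_val t - 1))).
  move=> t.
  apply: (@continuous_comp _ _ _ (fun t => clamp (2 * I01_val t - 1)) q).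
    apply: (@continuous_comp _ _ _ (fun t => 2 * I01_val t - 1) (@clamp R)).
      apply: (@continuous_comp _ _ _
        (fun t => 2 * I01_val t) (fun x : R => x - 1)).
        exact: c2.
      by apply: (@cvgB R R); [exact: cvg_id|exact: cvg_cst].
    exact: clamp_continuous.
  exact: cq.
pose A := [set t : I01 R | I01_val t <= 2^-1].
pose B := [set t : I01 R | 2^-1 <= I01_val t].
have cA : closed A.
  have /continuous_closedP vc := val_I01_continuous.
  exact: (vc _ (@closed_le R 2^-1)).
have cB : closed B.
  have /continuous_closedP vc := val_I01_continuous.
  exact: (vc _ (@closed_ge R 2^-1)).
have AB : A `|` B = setT.
  rewrite -subTset => t _.
  by case: (leP (I01_val t) 2^-1) => ?; [left|right; apply: ltW].
apply/continuous_subspace_setT; rewrite -AB; apply: withinU_continuous => //.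
- apply: (@subspace_eq_continuous _ _ _
    (fun t : I01 R => p (clamp (2 * I01_val t)))).
    by move=> t /set_mem tA; rewrite /from_subspace /concat ifT.
  exact: continuous_subspaceT.
- apply: (@subspace_eq_continuous _ _ _
    (fun t : I01 R => q (clamp (2 * I01_val t - 1)))).
    move=> t /set_mem t2; rewrite /from_subspace /concat.
    case: (leP (I01_val t) 2^-1) => // t1.
    have -> : I01_val t = 2^-1 by apply/eqP; rewrite eq_le t1 t2.
    rewrite mulfV ?pnatr_eq0 // subrr; exact/esym/pq.
  exact: continuous_subspaceT.
Qed.

Lemma concat_zero p q : concat p q zero = p zero.
Proof.
rewrite /concat -[X in I01_val X]/(clamp 0) val_clamp ?lexx ?ler01 //.
by rewrite invr_ge0 ler0n mulr0.
Qed.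

Lemma concat_one p q : concat p q one = q one.
Proof.
rewrite /concat -[X in I01_val X]/(clamp 1) val_clamp ?lexx ?ler01 //.
rewrite leNgt invf_lt1 ?ltr0n // ltr1n /= mulr1.
by rewrite -[2]/(1 + 1 : R) addrK.
Qed.

End concatenation.

Section path_concatenation.
Context (R : realType) (T : topologicalType) (x y z : T).
Context (p : {path (I01 R) from x to y}) (q : {path (I01 R) from y to z}).

Lemma pconcat_continuous : continuous (concat p q).
Proof.
by apply: concat_continuous; rewrite ?path_one ?path_zero//; exact: cts_fun.
Qed.

Lemma pconcat_zero : concat p q zero = x.
Proof. by rewrite concat_zero path_zero. Qed.

Lemma pconcat_one : concat p q one = z.
Proof. by rewrite concat_one path_one. Qed.

Definition pconcat : {path (I01 R) from x to z} :=
  mk_path pconcat_continuous pconcat_zero pconcat_one.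

End path_concatenation.

Section homotopy.
Context (R : realType).
Local Notation I := (I01 R).

Definition path_homotopic (T : topologicalType) (p q : I -> T) : Prop :=
  exists H : I * I -> T, [/\ continuous H,
    forall t, H (t, zero) = p t,
    forall t, H (t, one) = q t,
    forall s, H (zero, s) = p zero &
    forall s, H (one, s) = p one].

Definition path_connected (T : topologicalType) (A : set T) : Prop :=
  A !=set0 /\ forall x y, A x -> A y ->
    exists p : {path I from x to y in T}, forall t, A (p t).

Definition locally_path_connected (T : topologicalType) : Prop :=
  forall (x : T) (U : set T), nbhs x U ->
    exists V, [/\ open V, V x, V `<=` U & path_connected V].

Definition semilocally_simply_connected (T : topologicalType) : Prop :=
  forall x : T, exists2 U, nbhs x U &
    forall l : {path I from x to x in T}, (forall t, U (l t)) ->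
      path_homotopic l (cst x).

Definition simply_connected (T : topologicalType) : Prop :=
  path_connected [set: T] /\
  forall (x : T) (l : {path I from x to x in T}), path_homotopic l (cst x).

End homotopy.

Definition evenly_covered (E B : topologicalType) (p : E -> B) (U : set B) :=
  exists sheets : set (set E), [/\
    forall V, sheets V -> open V,
    trivIset sheets id,
    \bigcup_(V in sheets) V = p @^-1` U &
    forall V, sheets V -> exists s : B -> E, [/\
      {within U, continuous s},
      forall b, U b -> V (s b) /\ p (s b) = b &
      forall e, V e -> s (p e) = e]].

Definition covering_map (E B : topologicalType) (p : E -> B) : Prop :=
  [/\ continuous p, forall b, exists e, p e = b &
    forall b, exists U, [/\ open U, U b & evenly_covered p U]].

Definition universal_covering_group (R : realType)
    (G Gt : topologicalGroupType) (p : Gt -> G) : Prop :=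
  [/\ {morph p : x y / (x * y)%g}, covering_map p & simply_connected R Gt].

Definition expgz (G : groupType) (g : G) (n : int) : G :=
  match n with Posz m => (g ^+ m)%g | Negz m => (g ^- m.+1)%g end.

Definition homogeneous_quasimorphism (R : realType) (G : groupType)
    (mu : G -> R) : Prop :=
  (exists C : R, forall g h : G, `|mu (g * h)%g - mu g - mu h| <= C) /\
  (forall (g : G) (n : int), mu (expgz g n) = n%:~R * mu g).

Record gspace (G : topologicalGroupType) (B : topologicalType) := GSpace {
  gtotal :> topologicalType;
  gproj : gtotal -> B;
  gact : gtotal -> G -> gtotal
}.

Section principal_bundles.
Context (G : topologicalGroupType) (B : topologicalType).

Definition trivial_over (E : gspace G B) (U : set B) : Prop :=
  exists (phi : E -> B * G) (psi : B * G -> E), [/\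
    {within @gproj _ _ E @^-1` U, continuous phi} /\
      {within U `*` [set: G], continuous psi},
    forall e, U (gproj e) -> psi (phi e) = e,
    forall b g, U b -> gproj (psi (b, g)) = b /\ phi (psi (b, g)) = (b, g),
    forall e, U (gproj e) -> (phi e).1 = gproj e &
    forall e g, U (gproj e) -> phi (gact e g) = ((phi e).1, ((phi e).2 * g)%g)].

Definition is_principal (E : gspace G B) : Prop :=
  [/\ continuous (@gproj _ _ E),
    continuous (fun eg : E * G => gact eg.1 eg.2),
    (forall e : E, gact e 1%g = e) /\
      (forall (e : E) g h, gact e (g * h)%g = gact (gact e g) h),
    forall (e : E) g, gproj (gact e g) = gproj e &
    forall b, exists U, [/\ open U, U b & trivial_over E U]].

Record principal_bundle := PrincipalBundle {
  bundle_gspace :> gspace G B;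
  bundleP : is_principal bundle_gspace
}.

Definition gspace_iso (E F : gspace G B) : Prop :=
  exists (f : E -> F) (f' : F -> E), [/\
    continuous f /\ continuous f', cancel f f' /\ cancel f' f,
    forall e, gproj (f e) = gproj e &
    forall e g, f (gact e g) = gact (f e) g].

End principal_bundles.

Section universal_cover.
Context (R : realType) (B : topologicalType) (b0 : B).
Local Notation I := (I01 R).

Definition based_path := {y : B & {path I from b0 to y in B}}.

HB.instance Definition _ := Choice.on based_path.

Definition based_homotopic (c d : based_path) : Prop :=
  path_homotopic (tagged c) (tagged d).

(* Homotopy relative to the endpoints is already an equivalence relation, so
   passing to the generated one identifies nothing more. *)
Definition ucover := quot_by based_homotopic.

HB.instance Definition _ := Choice.on ucover.
HB.instance Definition _ := EqQuotient.on ucover.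

Definition pclass (y : B) (c : {path I from b0 to y in B}) : ucover :=
  \pi_ucover (Tagged (fun y => {path I from b0 to y in B}) c).

(* The usual topology, with basic open sets {[c * d] | d a path in U} for
   U an open neighbourhood of the endpoint of c. *)
Definition ucover_open (O : set ucover) : Prop :=
  forall (y : B) (c : {path I from b0 to y in B}), O (pclass c) ->
  exists U, [/\ open U, U y &
    forall (z : B) (d : {path I from y to z in B}),
      (forall t, U (d t)) -> O (pclass (pconcat c d))].

Lemma ucover_openT : ucover_open setT.
Proof. by move=> y c _; exists setT; split => //; exact: openT. Qed.

Lemma ucover_openI : setI_closed ucover_open.
Proof.
move=> O P oO oP y c [/oO[U [oU Uy UO]] /oP[V [oV Vy VP]]].
exists (U `&` V); split => //; first exact: openI.
by move=> z d dUV; split; [apply: UO|apply: VP] => t; have [] := dUV t.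
Qed.

Lemma ucover_open_bigU (J : Type) (f : J -> set ucover) :
  (forall i, ucover_open (f i)) -> ucover_open (\bigcup_i f i).
Proof.
move=> of_ y c [i _ /of_[U [oU Uy UO]]]; exists U; split => // z d dU.
by exists i => //; exact: UO.
Qed.

HB.instance Definition _ := isOpenTopological.Build ucover
  ucover_openT ucover_openI ucover_open_bigU.

Definition ucover_proj (x : ucover) : B := tag (repr x).

Lemma ucover_projE (y : B) (c : {path I from b0 to y in B}) :
  ucover_proj (pclass c) = y.
Proof.
rewrite /ucover_proj /pclass; case: piP => d /eqP.
rewrite eqmodE => /asboolP cd.
suff -> : tag d = tag (Tagged (fun y => {path I from b0 to y in B}) c) by [].
elim: cd => {y c d} [[y c] [z d]|//|c d _ -> //|c d e _ <- _ <- //].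
case=> H [_ _ /= H1 _ H2]; change (z = y).
have cy : c one = y by exact: path_one.
have dz : d one = z by exact: path_one.
by apply: etrans cy; apply: etrans (esym dz) _; rewrite -H1 H2.
Qed.

(* The action of the class of l in the fundamental group. *)
Definition loop_act (l : {path I from b0 to b0 in B}) (x : ucover) : ucover :=
  pclass (pconcat l (tagged (repr x))).

(* A homomorphism from pi_1(B, b0) to G, given on representatives. *)
Record pi1_hom (G : groupType) := Pi1Hom {
  pi1_fun :> {path I from b0 to b0 in B} -> G;
  pi1_homotopic : forall l m : {path I from b0 to b0 in B},
    path_homotopic l m -> pi1_fun l = pi1_fun m;
  pi1_morph : forall l m : {path I from b0 to b0 in B},
    pi1_fun (pconcat l m) = (pi1_fun l * pi1_fun m)%g
}.

Section induced.
Context (G : topologicalGroupType) (rho : pi1_hom G).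

(* Orbits of the diagonal left action l . (x, g) = (l . x, rho l * g); it commutes
   with right multiplication by G on the second factor. *)
Definition pi1_translate (z w : (ucover * G)%type) : Prop :=
  exists l, w = (loop_act l z.1, (rho l * z.2)%g).

Definition induced_total := quotient_topology (quot_by pi1_translate).

Definition induced_bundle : gspace G B :=
  @GSpace G B induced_total
    (fun e => ucover_proj (repr e).1)
    (fun e g => \pi_induced_total ((repr e).1, ((repr e).2 * g)%g)).

Lemma induced_actE (x : ucover) (g k : G) :
  gact (\pi_induced_total (x, g) : induced_bundle) k =
  \pi_induced_total (x, (g * k)%g).
Proof.
rewrite /gact /=; case: piP => -[y m] /gen_equivP /= xy.
apply/gen_equivP; apply: rst_sym.
change (clos_refl_sym_trans _ pi1_translate
  ((x, g).1, ((x, g).2 * k)%g) ((y, m).1, ((y, m).2 * k)%g)).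
elim: xy => [z w [l ->]|z|z w _|u v w _ uv _ vw].
- by apply: rst_step; exists l; rewrite /= mulgA.
- exact: rst_refl.
- exact: rst_sym.
- exact: rst_trans vw.
Qed.

Lemma induced_projE (x : ucover) (g : G) :
  gproj (\pi_induced_total (x, g) : induced_bundle) = ucover_proj x.
Proof.
rewrite /gproj /=; case: piP => z /gen_equivP.
rewrite -[x in RHS]/((x, g).1); elim=> {x g z} //=.
- by move=> z w [l ->]; rewrite /= /loop_act ucover_projE.
- by move=> u v w _ -> _ ->.
Qed.

End induced.
End universal_cover.

(* E is isomorphic to the bundle (universal cover x G) / pi_1 induced by some
   homomorphism pi_1(B, b0) -> G; for path-connected B the choice of b0 is
   immaterial. *)
Definition admits_foliated_structure (R : realType) (G : topologicalGroupType)
    (B : topologicalType) (E : principal_bundle G B) : Prop :=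
  exists (b0 : B) (rho : pi1_hom R b0 G), gspace_iso E (induced_bundle rho).

Section surfaces.
Context (R : realType) (h : nat).

Definition disk : Type :=
  set_type ([set z | z.1 ^+ 2 + z.2 ^+ 2 <= 1] : set (R * R)).

HB.instance Definition _ := Topological.on disk.

Definition disk_val (x : disk) : R * R := sval x.

(* The boundary circle as a polygon with 4h sides; side k is the image of
   [k, k + 1]. *)
Definition boundary_point (s : R) : R * R :=
  (cos (2 * pi * s / (4 * h)%:R), sin (2 * pi * s / (4 * h)%:R)).

(* Sides k and k + 2 are glued with reversed orientation, for k = 0, 1 modulo 4;
   the boundary word is the product of the a_i b_i a_i^-1 b_i^-1. *)
Definition glue (x y : disk) : Prop :=
  exists (k : nat) (t : R), [/\ (k < 4 * h)%N, (k %% 4 < 2)%N, 0 <= t <= 1,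
    disk_val x = boundary_point (k%:R + t) &
    disk_val y = boundary_point ((k + 2)%:R + (1 - t))].

Definition surface := quotient_topology (quot_by glue).

End surfaces.

Definition homeomorphic (S T : topologicalType) : Prop :=
  exists (f : S -> T) (g : T -> S),
    [/\ continuous f, continuous g, cancel f g & cancel g f].

(* A closed oriented surface of genus h >= 1 is, up to homeomorphism, the standard
   model obtained from the 4h-gon. *)
Definition closed_oriented_surface (R : realType) (h : nat)
    (S : topologicalType) : Prop := homeomorphic S (surface R h).

(* Main.v *)
(** Pull a principal bundle [E] back along the quotient map [q] from the polygon
    onto the surface and choose a section [s] over the disk. On a pair of glued
    sides [s] jumps by a path in [G]; lifting these paths to [Gt] and multiplying
    their end values around the single vertex of the polygon gives an element of
    [ker p], the obstruction. Another section differs from [s] by a map from the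
    disk to [G], which lifts to [Gt], and [ker p] is discrete and central, so the
    obstruction depends only on the isomorphism class of [E].

    Clutching along a loop around the centre of the polygon realizes every power
    of [gamma] as an obstruction. If [E] is induced by a homomorphism from the
    fundamental group, the radial paths of the polygon give a section with constant
    jumps, so that the obstruction is a product of [h] commutators, on which [mu]
    is bounded. Since [mu] is unbounded on the powers of [gamma], almost all of
    these bundles are not foliated. *)
Require Import Defs.
From HB Require Import structures.
From Stdlib Require Import Relation_Operators.
From mathcomp Require Import all_boot all_order all_algebra generic_quotient.
From mathcomp Require Import all_classical all_reals all_analysis homotopy.
From mathcomp Require Import ring lra zify.
Set Implicit Arguments.
Unset Strict Implicit.
Unset Printing Implicit Defensive.
Import Order.TTheory GRing.Theory Num.Theory.
Import numFieldNormedType.Exports.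
Local Open Scope classical_set_scope.
Local Open Scope ring_scope.
Local Open Scope quotient_scope.

(** * Continuity of pointwise operations, and homomorphisms of groups *)

Lemma continuousT_comp (X Y Z : topologicalType) (g : Y -> Z) (f : X -> Y) :
  continuous g -> continuous f -> continuous (fun x => g (f x)).
Proof. by move=> cg cf x; apply: continuous_comp; [exact: cf|exact: cg]. Qed.

Lemma continuous_pair (X Y Z : topologicalType) (f : X -> Y) (g : X -> Z) x :
  {for x, continuous f} -> {for x, continuous g} ->
  {for x, continuous (fun x => (f x, g x))}.
Proof. by move=> cf cg; exact: cvg_pair. Qed.

Lemma continuousT_pair (X Y Z : topologicalType) (f : X -> Y) (g : X -> Z) :
  continuous f -> continuous g -> continuous (fun x => (f x, g x)).
Proof. by move=> cf cg x; apply: continuous_pair; [exact: cf|exact: cg]. Qed.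

Lemma continuous_fst (X Y : topologicalType) : continuous (@fst X Y).
Proof. by move=> x; exact: cvg_fst. Qed.

Lemma continuous_snd (X Y : topologicalType) : continuous (@snd X Y).
Proof. by move=> x; exact: cvg_snd. Qed.

Section real_valued.
Context (R : realType) (X : topologicalType).

Lemma continuousRD (f g : X -> R) : continuous f -> continuous g ->
  continuous (fun x => f x + g x).
Proof. by move=> cf cg x; apply: (@cvgD R R); [exact: cf|exact: cg]. Qed.

Lemma continuousRM (f g : X -> R) : continuous f -> continuous g ->
  continuous (fun x => f x * g x).
Proof. by move=> cf cg x; apply: (@cvgM R); [exact: cf|exact: cg]. Qed.

Lemma continuousRN (f : X -> R) : continuous f -> continuous (fun x => - f x).
Proof. by move=> cf x; apply: (@cvgN R R); exact: cf. Qed.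

Lemma continuousRB (f g : X -> R) : continuous f -> continuous g ->
  continuous (fun x => f x - g x).
Proof. by move=> cf cg; apply: continuousRD => //; exact: continuousRN. Qed.

Lemma continuous_paste (T : topologicalType) (u : X -> R) (a : R) (f g : X -> T) :
  continuous u -> continuous f -> continuous g ->
  (forall x, u x = a -> f x = g x) ->
  continuous (fun x => if u x <= a then f x else g x).
Proof.
move=> cu cf cg fg; pose k x := if u x <= a then f x else g x.
have kg x : a <= u x -> k x = g x.
  by rewrite /k; case: ltgtP => // ua _; exact: fg.
have cA : closed [set x | u x <= a].
  by have /continuous_closedP cuP := cu; exact: (cuP _ (@closed_le R a)).
have cB : closed [set x | a <= u x].
  by have /continuous_closedP cuP := cu; exact: (cuP _ (@closed_ge R a)).
have AB : [set x | u x <= a] `|` [set x | a <= u x] = setT.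
  by rewrite -subTset => x _; case: (leP (u x) a) => ?; [left|right; exact: ltW].
apply/continuous_subspace_setT; rewrite -AB; apply: withinU_continuous => //.
- apply: (@subspace_eq_continuous _ _ _ f); last exact: continuous_subspaceT.
  by move=> x /set_mem /= xa; rewrite /from_subspace xa.
- apply: (@subspace_eq_continuous _ _ _ g); last exact: continuous_subspaceT.
  by move=> x /set_mem /= xa; rewrite /from_subspace -[RHS]/(k x) kg.
Qed.

End real_valued.

Section group_homomorphisms.
Context (G H : groupType) (p : G -> H) (pM : {morph p : x y / (x * y)%g}).

Lemma group_homM1 : p 1%g = 1%g.
Proof. by apply: (@mulgI _ (p 1%g)); rewrite -pM !mulg1. Qed.

Lemma group_homV x : p (x^-1)%g = (p x)^-1%g.
Proof. by apply: (@mulgI _ (p x)); rewrite -pM !mulgV group_homM1. Qed.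

Lemma group_homX x n : p (x ^+ n)%g = (p x ^+ n)%g.
Proof.
by elim: n => [|n IHn]; rewrite ?expg0 ?group_homM1// !expgS pM IHn.
Qed.

End group_homomorphisms.

Section topological_groups.
Context (G : topologicalGroupType) (T : Type) (F : set_system T) {FF : Filter F}.

Lemma cvgMg (f g : T -> G) (a b : G) :
  f @ F --> a -> g @ F --> b -> (fun t => f t * g t)%g @ F --> (a * b)%g.
Proof. exact: continuous2_cvg (@mulg_continuous G (a, b)). Qed.

Lemma cvgVg (f : T -> G) (a : G) :
  f @ F --> a -> (fun t => (f t)^-1)%g @ F --> (a^-1)%g.
Proof. exact: continuous_cvg (@invg_continuous G a). Qed.

End topological_groups.

Section continuous_group_operations.
Context (G : topologicalGroupType) (X : topologicalType).

Lemma continuousMg (f g : X -> G) : continuous f -> continuous g ->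
  continuous (fun x => (f x * g x)%g).
Proof. by move=> cf cg x; apply: cvgMg; [exact: cf|exact: cg]. Qed.

Lemma continuousVg (f : X -> G) : continuous f ->
  continuous (fun x => (f x)^-1%g).
Proof. by move=> cf x; apply: cvgVg; exact: cf. Qed.

Lemma continuous_prodg n (f : nat -> X -> G) :
  (forall i, (i < n)%N -> continuous (f i)) ->
  continuous (fun x => (\prod_(0 <= i < n) f i x)%g).
Proof.
elim: n => [_|n IHn cf].
  by under eq_fun do rewrite big_nil; exact: cst_continuous.
under eq_fun do rewrite big_nat_recr//=.
by apply: continuousMg; [apply: IHn => i /ltnW/cf|exact: cf].
Qed.

End continuous_group_operations.

(** * Freeness and division in principal bundles *)

Section principal_bundles.
Context (G : topologicalGroupType) (B : topologicalType) (E : principal_bundle G B).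

Lemma principal_act_free (e : E) (g k : G) : gact e g = gact e k -> g = k.
Proof.
have [_ _ _ _ /(_ (gproj e))[U [_ Ue [phi [psi [_ _ _ _ phiM]]]]]] := bundleP E.
move=> /(congr1 phi); rewrite !phiM// => -[]; exact: mulgI.
Qed.

(** In a local trivialization [phi] the quotient of the two maps is the product of the inverse of
    [(phi (s y)).2] with [(phi (s' y)).2], which is continuous. Freeness of the action makes these
    local formulas agree with the globally chosen [u]. *)
Lemma principal_division (X : topologicalType) (s s' : X -> E) :
  continuous s -> continuous s' -> (forall x, gproj (s x) = gproj (s' x)) ->
  exists2 u : X -> G, continuous u & forall x, s' x = gact (s x) (u x).
Proof.
move=> cs cs' ss'.
have [cproj _ [_ _] projg loc] := bundleP E.
have loc' x : exists2 phi : E -> B * G,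
    {for s x, continuous phi} /\ {for s' x, continuous phi} &
    \forall y \near x, s' y = gact (s y) ((phi (s y)).2^-1 * (phi (s' y)).2)%g.
  have [U [oU Ux [phi [psi [[cphi _] psiK _ phi1 phiM]]]]] := loc (gproj (s x)).
  have oV : open (@gproj _ _ E @^-1` U) by move/continuousP : cproj; exact.
  have cphiV e : U (gproj e) -> {for e, continuous phi}.
    by move: cphi; rewrite continuous_open_subspace// => cphi Ue;
      exact/cphi/mem_set.
  exists phi; first by split; apply: cphiV; rewrite -?ss'.
  have : nbhs x (s @^-1` (@gproj _ _ E @^-1` U)).
    by apply: cs; apply: open_nbhs_nbhs.
  apply: filterS => y /= Uy; have Uy' : U (gproj (s' y)) by rewrite -ss'.
  rewrite -[LHS]psiK// -[RHS]psiK ?projg// phiM// mulVKg.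
  by rewrite phi1// ss' -phi1//; case: (phi _).
have ex_u x : exists g, s' x = gact (s x) g.
  by have [phi _ /nbhs_singleton ->] := loc' x; eexists.
have [u uE] := choice ex_u.
exists u => // x; have [phi [cphi cphi'] su] := loc' x.
have uN : \forall y \near x, ((phi (s y)).2^-1 * (phi (s' y)).2)%g = u y.
  by apply: filterS su => y sy; apply: (@principal_act_free (s y)); rewrite -uE.
rewrite /continuous_at -(nbhs_singleton uN); apply: cvg_trans (near_eq_cvg uN) _.
have c2 (r : X -> E) : continuous r -> {for r x, continuous phi} ->
    (phi (r y)).2 @[y --> x] --> (phi (r x)).2.
  move=> cr cphir; apply: (@continuous_comp _ _ _ (phi \o r) snd).
    by apply: continuous_comp => //; exact: cr.
  exact: cvg_snd.
by apply: cvgMg; [apply: cvgVg|]; exact: c2.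
Qed.

End principal_bundles.

(** * Covering groups *)

Section locally_constant.
Context (X : topologicalType) (T : Type).

Lemma connected_locally_constant (w : X -> T) : connected [set: X] ->
  (forall x, \forall y \near x, w y = w x) -> forall x y, w x = w y.
Proof.
move=> cX lw x y.
have ow (P : T -> Prop) : open [set z | P (w z)].
  by rewrite openE => z /= Pz; apply: filterS (lw z) => z' zz'; rewrite /= zz'.
have wxT : [set z | w x = w z] = setT.
  apply: cX; first by exists x.
    by exists [set z | w x = w z]; rewrite ?setTI//; exact: ow.
  exists [set z | w x = w z]; rewrite ?setTI//.
  by rewrite -openC; exact: (ow (fun t => w x <> t)).
by have : [set z | w x = w z] y by rewrite wxT.
Qed.

End locally_constant.

Section covering_groups.
Context (R : realType) (G Gt : topologicalGroupType) (p : Gt -> G).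
Hypotheses (pM : {morph p : x y / (x * y)%g}) (p_cov : covering_map p).

(** The section comes from the sheet through 1 over an evenly covered neighbourhood of 1. The last
    clause, discreteness of the kernel, holds because that sheet meets each fibre at most once. *)
Lemma covering_local_section : exists (V : set G) (sg : G -> Gt),
  [/\ open V, V 1%g, forall v, V v -> {for v, continuous sg},
    forall v, V v -> p (sg v) = v &
    \forall x \near (1%g : Gt), p x = 1%g -> x = 1%g].
Proof.
have [cp _ /(_ 1%g)[U [oU U1 [sheets [osh tsh shU secs]]]]] := p_cov.
have [V Vsh V1] : (\bigcup_(V in sheets) V) (1%g : Gt).
  by rewrite shU /= group_homM1.
have [sg [csg sgP sgK]] := secs _ Vsh.
exists U, sg; split => //.
- by move: csg; rewrite continuous_open_subspace// => csg v /mem_set; exact: csg.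
- by move=> v /sgP[].
- have : nbhs (1%g : Gt) V by apply: open_nbhs_nbhs; split => //; exact: osh.
  apply: filterS => x Vx px.
  by rewrite -[LHS]sgK// px -[1%g in LHS](group_homM1 pM) sgK.
Qed.

Lemma covering_ker_constant (X : topologicalType) (w : X -> Gt) :
  connected [set: X] -> continuous w -> (forall x, p (w x) = 1%g) ->
  forall x y, w x = w y.
Proof.
move=> cX cw pw; apply: connected_locally_constant cX _ => x.
have [_ [_ [_ _ _ _ ker1]]] := covering_local_section.
have : (fun y => (w y * (w x)^-1)%g) @ x --> (1%g : Gt).
  rewrite -[1%g in X in _ --> X](mulgV (w x)).
  by apply: cvgMg; [exact: cw|exact: cvg_cst].
move=> cwx; have kw : \forall y \near x, p (w y * (w x)^-1)%g = 1%g ->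
  (w y * (w x)^-1)%g = 1%g := cwx _ ker1.
apply: filterS kw => y kery; apply/eqP; rewrite -divg_eq1.
by apply/eqP/kery; rewrite pM (group_homV pM) !pw mulgV.
Qed.

(** Precomposing with [clamp] makes [w] take values in the kernel on the whole line, which is
    connected. *)
Lemma covering_ker_itv (w : R -> Gt) : continuous w ->
  (forall t, 0 <= t <= 1 -> p (w t) = 1%g) -> w 0 = w 1.
Proof.
move=> cw pw.
have cc : continuous (fun t : R => I01_val (clamp t)).
  exact: continuousT_comp (@val_I01_continuous R) (@clamp_continuous R).
have := @covering_ker_constant R (fun t => w (I01_val (clamp t))).
move=> /(_ _ _ _ 0 1); rewrite !val_clamp ?lexx ?ler01//; apply.
- by apply/connected_intervalP => x y _ _ z _.
- exact: continuousT_comp cw cc.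
- by move=> t; apply: pw; case: (clamp t) => x /= /set_mem /=; rewrite in_itv.
Qed.

(** Conjugating [z] along a path from 1 to [g] gives a path in the discrete kernel, hence a constant
    one. *)
Lemma covering_ker_central (Gt_pc : path_connected R [set: Gt]) (z : Gt) :
  p z = 1%g -> forall g, (z * g = g * z)%g.
Proof.
move=> pz g; have [_ /(_ 1%g g I I)[a _]] := Gt_pc.
have ca : continuous (fun t : R => a (clamp t)).
  exact: continuousT_comp (@cts_fun _ _ a) (@clamp_continuous R).
pose w (t : R) := (a (clamp t) * z * (a (clamp t))^-1)%g.
have : w 0 = w 1.
  apply: covering_ker_itv; last first.
    by move=> t _; rewrite !pM (group_homV pM) pz mulg1 mulgV.
  apply: continuousMg; last exact: continuousVg.
  by apply: continuousMg => //; exact: cst_continuous.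
rewrite /w -[clamp 0]/zero -[clamp 1]/one path_zero path_one invg1 mul1g mulg1.
by move=> {1}->; rewrite mulgVK.
Qed.

End covering_groups.

(** * Lifting homotopies through a covering group *)

Section lifting.
Context (R : realType) (G : topologicalGroupType) (X : topologicalType).
Hypothesis X_compact : compact [set: X].

Lemma uniform_subdivision (v : R * X -> G) (V : set G) :
  continuous v -> nbhs 1%g V ->
  exists N, forall x i, (i < N.+1)%N ->
    V ((v (i%:R / N.+1%:R, x)%R)^-1 * v (i.+1%:R / N.+1%:R, x)%R)%g.
Proof.
move=> cv V1.
pose K := `[0, 1]%classic `*` [set: X] : set (R * X).
have cK : near_covering K.
  by apply/compact_near_coveringP/compact_setX => //; exact: segment_compact.
(* Compactness is used as near-covering: it suffices that each point has a neighbourhood on which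
   [P N] holds for all large [N]. *)
pose P (N : nat) (tx : R * X) := forall t' : R, `|t' - tx.1| <= N.+1%:R^-1 ->
  V ((v tx)^-1 * v (t', tx.2))%g.
have [N _ NP] : \forall N \near \oo, K `<=` P N.
  apply: cK => -[t x] _ /=.
  pose f (y : (R * X) * R) := ((v y.1)^-1 * v (y.2, y.1.2))%g.
  have cf : continuous f.
    apply: continuousMg.
      exact/continuousVg/(continuousT_comp cv)/continuous_fst.
    apply: (continuousT_comp cv); apply: continuousT_pair.
      exact: continuous_snd.
    exact: continuousT_comp (@continuous_snd _ _) (@continuous_fst _ _).
  have : nbhs ((t, x), t) (f @^-1` V) by apply: cf; rewrite /f/= mulVg.
  (* The radius [e] is halved: one half for moving the base time [t] to [t1], the other for the
     mesh. *)
  case=> -[A B] /= [Atx /nbhs_ballP[e /= e0 eB]] ABV.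
  have e2 : 0 < e / 2 by rewrite divr_gt0.
  exists (A `&` [set y | `|t - y.1| < e / 2], [set N | N.+1%:R^-1 < e / 2]).
    split => /=; last exact: near_infty_natSinv_lt (PosNum e2).
    apply: filterI => //.
    exact: (@continuous_fst _ _ (t, x) _ (nbhsx_ballx (t : R) _ e2)).
  move=> [[t1 x1] N] /= [[A1 tt1] N2] t' tt'; apply: (ABV ((t1, x1), t')).
  split=> //=; apply: eB; rewrite /ball/= (splitr e).
  rewrite (le_lt_trans (ler_distD t1 _ _))// ltrD// distrC.
  exact: le_lt_trans tt' _.
exists N => x i iN.
apply: (NP N (leqnn N) (i%:R / N.+1%:R, x)) => /=.
  split => //=; rewrite in_itv/= divr_ge0 ?ler0n//= ler_pdivrMr ?ltr0n// mul1r.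
  by rewrite ler_nat ltnW.
by rewrite -mulrBl -natrB// subSnn mul1r ger0_norm// invr_ge0 ler0n.
Qed.

(* The quotients of consecutive values of [v] along a fine subdivision stay in the
   domain of a local section of [p]; the lift is the product of their images. *)
Lemma lift_contraction (Gt : topologicalGroupType) (p : Gt -> G)
    (v : R * X -> G) (g0 : Gt) :
  {morph p : x y / (x * y)%g} -> covering_map p -> continuous v ->
  (forall x, v (0, x) = p g0) ->
  exists2 U : X -> Gt, continuous U & forall x, p (U x) = v (1, x).
Proof.
move=> pM p_cov cv v0.
have [V [sg [oV V1 csg psg _]]] := covering_local_section pM p_cov.
have [N VN] := uniform_subdivision cv (open_nbhs_nbhs (conj oV V1)).
pose d i x := ((v (i%:R / N.+1%:R, x)%R)^-1 * v (i.+1%:R / N.+1%:R, x)%R)%g.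
exists (fun x => g0 * \prod_(0 <= i < N.+1) sg (d i x))%g.
  apply: continuousMg; first exact: cst_continuous.
  apply: continuous_prodg => i iN x.
  apply: (@continuous_comp _ _ _ (d i) sg); last exact/csg/VN.
  have cvi (r : R) : continuous (fun x => v (r, x)).
    apply: (continuousT_comp cv); apply: continuousT_pair;
      last by move=> y; exact: cvg_id.
    exact: cst_continuous.
  by apply: continuousMg; [exact: continuousVg|].
move=> x; rewrite pM -(v0 x).
(* The images of the partial products telescope, so they follow [v] along the subdivision. *)
suff H n : (n <= N.+1)%N ->
    (v (0, x) * p (\prod_(0 <= i < n) sg (d i x)))%g = v (n%:R / N.+1%:R, x).
  by rewrite H// divff ?pnatr_eq0.
elim: n => [_|n IHn nN]; first by rewrite big_nil (group_homM1 pM) mulg1 mul0r.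
by rewrite big_nat_recr//= pM mulgA IHn 1?ltnW// psg ?mulVKg//; exact: VN.
Qed.

End lifting.

(** * The obstruction of a bundle over the surface *)

Section disk_geometry.
Context (R : realType).
Local Notation disk := (disk R).
Local Notation disk_val := (@disk_val R).

Lemma disk_val_continuous : continuous disk_val.
Proof. exact: initial_continuous. Qed.

Lemma disk_continuous (X : topologicalType) (f : X -> disk) :
  continuous (fun x => disk_val (f x)) -> continuous f.
Proof. exact: continuous_comp_initial. Qed.

Lemma disk_val_inj : injective disk_val.
Proof. exact: val_inj. Qed.

Lemma disk_valP (x : disk) : (disk_val x).1 ^+ 2 + (disk_val x).2 ^+ 2 <= 1.
Proof. by case: x => x /= /set_mem. Qed.

Lemma disk_compact : compact [set: disk].
Proof.
pose D := [set z : R * R | z.1 ^+ 2 + z.2 ^+ 2 <= 1].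
have cD : compact D.
  apply: (@subclosed_compact _ D (`[-1, 1] `*` `[-1, 1])).
  - pose f (z : R * R) := z.1 ^+ 2 + z.2 ^+ 2.
    have /continuous_closedP cf : continuous f.
      apply: continuousRD; apply: (continuousT_comp (@exprn_continuous R 2)).
        exact: continuous_fst.
      exact: continuous_snd.
    exact: cf _ (@closed_le R 1).
  - by apply: compact_setX; exact: segment_compact.
  - have sqr1 (x : R) : x ^+ 2 <= 1 -> x \in `[-1, 1].
      move=> x1; rewrite in_itv/= -ler_norml -(@expr_le1 _ 2)//.
      by rewrite real_normK// num_real.
    by move=> [x y] /= D1; split; apply: sqr1; apply: le_trans D1;
      rewrite ?lerDl ?lerDr sqr_ge0.
move=> F FF _; have FD : (disk_val @ F) D.
  by apply: (@filterS _ F _ setT) filterT => x _; exact: disk_valP.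
(* A cluster point of the image filter in the plane is one in [disk], whose topology is induced by
   [disk_val]. *)
have [x [Dx Fx]] := cD (disk_val @ F) _ FD.
exists (exist _ x (mem_set Dx)); split => // A B FA.
rewrite nbhsE => -[C [[C' oC' <-] C'x] CB].
have FA' : (disk_val @ F) (disk_val @` A).
  by apply: (@filterS _ F _ A) FA => a Aa; exists a.
have [_ [[a Aa <-] Ca]] := Fx _ _ FA' (open_nbhs_nbhs (conj oC' C'x)).
by exists a; split => //; exact: CB.
Qed.

Definition mk_disk (z : R * R) (z1 : z.1 ^+ 2 + z.2 ^+ 2 <= 1) : disk :=
  exist _ z (mem_set z1).

Lemma disk_valK z z1 : disk_val (@mk_disk z z1) = z.
Proof. by []. Qed.

Definition combination (t : R) (z w : R * R) : R * R :=
  ((1 - t) * z.1 + t * w.1, (1 - t) * z.2 + t * w.2).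

Lemma segment_subproof (t : I01 R) (x y : disk) :
  let z := combination (I01_val t) (disk_val x) (disk_val y) in
  z.1 ^+ 2 + z.2 ^+ 2 <= 1.
Proof.
rewrite /=; case: t => t /= /set_mem/=; rewrite in_itv/= => /andP[t0 t1].
move: (disk_valP x) (disk_valP y); move: (disk_val x) (disk_val y).
move=> [x1 x2] [y1 y2]; rewrite /I01_val/= => xx yy.
have tt : 0 <= t * (1 - t) by rewrite mulr_ge0// subr_ge0.
(* The squared norm of the combination is [(1 - t) |x|^2 + t |y|^2 - t (1 - t) |x - y|^2]. *)
have := mulr_ge0 tt (addr_ge0 (sqr_ge0 (x1 - y1)) (sqr_ge0 (x2 - y2))).
have t1' : 0 <= 1 - t by rewrite subr_ge0.
have := ler_wpM2l t1' xx; have := ler_wpM2l t0 yy.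
nra.
Qed.

Definition segment (t : I01 R) (x y : disk) : disk :=
  mk_disk (segment_subproof t x y).

Lemma segment0 x y : segment (clamp 0) x y = x.
Proof.
apply: disk_val_inj; rewrite disk_valK/combination val_clamp ?lexx ?ler01//.
by rewrite subr0 !mul1r !mul0r !addr0; case: (disk_val x).
Qed.

Lemma segment1 x y : segment (clamp 1) x y = y.
Proof.
apply: disk_val_inj; rewrite disk_valK/combination val_clamp ?lexx ?ler01//.
by rewrite subrr !mul1r !mul0r !add0r; case: (disk_val y).
Qed.

Lemma segment_continuous (X : topologicalType) (t : X -> I01 R) (x y : X -> disk) :
  continuous t -> continuous x -> continuous y ->
  continuous (fun a => segment (t a) (x a) (y a)).
Proof.
move=> ct cx cy; apply: disk_continuous; rewrite /disk_val/=.
have ct' := continuousT_comp (@val_I01_continuous R) ct.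
have cx' := continuousT_comp disk_val_continuous cx.
have cy' := continuousT_comp disk_val_continuous cy.
have c1 := continuousT_comp (@continuous_fst _ _) cx'.
have c2 := continuousT_comp (@continuous_snd _ _) cx'.
have d1 := continuousT_comp (@continuous_fst _ _) cy'.
have d2 := continuousT_comp (@continuous_snd _ _) cy'.
by apply: continuousT_pair; apply: continuousRD; apply: continuousRM => //;
  apply: continuousRB => //; exact: cst_continuous.
Qed.

Lemma center_subproof : (0 : R, 0 : R).1 ^+ 2 + (0 : R, 0 : R).2 ^+ 2 <= 1.
Proof. by rewrite /= expr0n/= addr0 ler01. Qed.

Definition disk_center : disk := mk_disk center_subproof.

Lemma boundary_subproof h (s : R) :
  (boundary_point h s).1 ^+ 2 + (boundary_point h s).2 ^+ 2 <= 1.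
Proof. by rewrite /= cos2Dsin2. Qed.

Definition boundary h (s : R) : disk := mk_disk (boundary_subproof h s).

Lemma boundaryE h s : disk_val (boundary h s) = boundary_point h s.
Proof. by []. Qed.

Lemma boundary_continuous h : continuous (boundary h).
Proof.
apply: disk_continuous; rewrite /disk_val/= /boundary_point.
have ca : continuous (fun s : R => 2 * pi * s / (4 * h)%:R).
  apply: continuousRM; last exact: cst_continuous.
  by apply: continuousRM; [exact: cst_continuous|move=> s; exact: cvg_id].
apply: continuousT_pair; apply: continuousT_comp ca.
  exact: continuous_cos.
exact: continuous_sin.
Qed.

Lemma boundary_period h : (0 < h)%N -> boundary h (4 * h)%:R = boundary h 0.
Proof.
move=> h0; apply: disk_val_inj; rewrite !boundaryE/boundary_point.
rewrite mulfK ?pnatr_eq0 ?muln_eq0 -?lt0n// mulr0 mul0r cos0 sin0.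
by rewrite mulrC mulr_natr cos2pi sin2pi.
Qed.

End disk_geometry.

(** The [u] are the changes of section at five consecutive corners; [a] and [b] are the kernel
    errors on the two glued pairs of sides. Each error enters the word once directly and once
    inverted, so by centrality it cancels. *)
Lemma handle_telescope (G : groupType) (x0 x1 y0 y1 x0' x1' y0' y1' : G)
    (u0 u1 u2 u3 u4 a b : G) :
  (forall g, a * g = g * a)%g -> (forall g, b * g = g * b)%g ->
  (x0 * u3 = u0 * x0' * a)%g -> (x1 * u2 = u1 * x1' * a)%g ->
  (y0 * u4 = u1 * y0' * b)%g -> (y1 * u3 = u2 * y1' * b)%g ->
  (x0 * y1^-1 * x1^-1 * y0 * u4 = u0 * (x0' * y1'^-1 * x1'^-1 * y0'))%g.
Proof.
move=> ca cb X0 X1 Y0 Y1; rewrite -[LHS]mulgA Y0.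
rewrite -(mulgK u3 x0) X0 -(mulgK u3 y1) Y1 -(mulgK u2 x1) X1.
rewrite !invgM !invgK !mulgA !mulgVK -!mulgA; congr (u0 * (x0' * _))%g.
by rewrite !mulgA -(mulgA a) ca mulgK -[LHS]cb !mulgA mulgV mul1g.
Qed.

(** * The obstruction and its invariance *)

Section obstruction.
Context (R : realType) (G Gt : topologicalGroupType) (p : Gt -> G).
Context (h : nat) (B : topologicalType).
Hypotheses (pM : {morph p : x y / (x * y)%g}) (p_cov : covering_map p).
Hypotheses (Gt_pc : path_connected R [set: Gt]) (h_gt0 : (0 < h)%N).

(** [C k] lifts to [Gt] the jump from side [k] to its partner [k + 2]. It is a function on the whole
    line, to avoid subspace topologies, but is tied to [s] only on the unit interval. *)
Definition edge_lift (E : gspace G B) (s : disk R -> E) (C : nat -> R -> Gt) :=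
  (forall k, continuous (C k)) /\
  forall k t, (k < 4 * h)%N -> (k %% 4 < 2)%N -> 0 <= t <= 1 ->
    s (boundary h ((k + 2)%:R + (1 - t))) =
    gact (s (boundary h (k%:R + t))) (p (C k t)).

(* The product of the jumps that carries [s] from corner [4 i] of the polygon to
   corner [4 i + 4]. *)
Definition handle_word (C : nat -> R -> Gt) (i : nat) : Gt :=
  (C (4 * i)%N 0%R * (C (4 * i + 1)%N 1%R)^-1 * (C (4 * i)%N 1%R)^-1
   * C (4 * i + 1)%N 0%R)%g.

Definition obstruction (C : nat -> R -> Gt) : Gt :=
  (\prod_(0 <= i < h) handle_word C i)%g.

Lemma handle_sides i : (i < h)%N ->
  [/\ (4 * i < 4 * h)%N, (4 * i %% 4 < 2)%N, (4 * i + 1 < 4 * h)%N &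
      ((4 * i + 1) %% 4 < 2)%N].
Proof. by move=> ih; split; lia. Qed.

Lemma corner0 (k : nat) : (k + 2)%:R + (1 - 0) = (k + 3)%:R :> R.
Proof. by rewrite !natrD; lra. Qed.

Lemma corner1 (k : nat) : (k + 2)%:R + (1 - 1) = (k + 2)%:R :> R.
Proof. by rewrite !natrD; lra. Qed.

(** The jumps carry [s] once through all corners and back to the first, and the action is free. *)
Lemma obstruction_pi1 (E : principal_bundle G B) (s : disk R -> E) C :
  edge_lift s C -> p (obstruction C) = 1%g.
Proof.
move=> [_ sC]; pose sn n := s (boundary h n%:R).
have actM (e : E) g k : @gact _ _ E e (g * k)%g = gact (gact e g) k.
  by have [_ _ []] := bundleP E.
have act1 (e : E) : @gact _ _ E e 1%g = e by have [_ _ []] := bundleP E.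
suff H n : (n <= h)%N ->
    sn (4 * n)%N = gact (sn 0%N) (p (\prod_(0 <= i < n) handle_word C i)%g).
  apply: (@principal_act_free _ _ E (sn 0%N)); rewrite -H// act1.
  by rewrite /sn boundary_period.
elim: n => [_|n IHn nh]; first by rewrite big_nil (group_homM1 pM) act1 muln0.
have [a1 a2 b1 b2] := handle_sides nh.
(* At [t = 0] corner [k] is glued to corner [k + 3]; at [t = 1] corner [k + 1] is glued to corner
   [k + 2]. *)
have C0 k : (k < 4 * h)%N -> (k %% 4 < 2)%N ->
    sn (k + 3)%N = gact (sn k) (p (C k 0)).
  by move=> k1 k2; rewrite /sn -corner0 sC ?lexx ?ler01// addr0.
have C1 k : (k < 4 * h)%N -> (k %% 4 < 2)%N ->
    sn (k + 2)%N = gact (sn (k + 1)%N) (p (C k 1)).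
  by move=> k1 k2; rewrite /sn -corner1 sC ?lexx ?ler01// natrD.
have actV g (e f : E) :
    e = @gact _ _ E f (p g) -> f = @gact _ _ E e (p g^-1%g).
  by move=> ->; rewrite -actM -pM mulgV (group_homM1 pM) act1.
(* The word visits the corners [4 n], [4 n + 3], [4 n + 2], [4 n + 1], [4 n + 4] in this order. *)
rewrite big_nat_recr//= pM actM -IHn 1?ltnW// /handle_word !pM !actM.
rewrite -(C0 _ a1 a2) (_ : 4 * n + 3 = 4 * n + 1 + 2)%N 1?addnA//; last by lia.
have <- := actV _ _ _ (C1 _ b1 b2).
rewrite (_ : 4 * n + 1 + 1 = 4 * n + 2)%N; last by lia.
have <- := actV _ _ _ (C1 _ a1 a2).
by rewrite -(C0 _ b1 b2); congr sn; lia.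
Qed.

(** This covers at once a change of section and a change of the lifts, so it serves both to
    distinguish bundles and to compute with a flat section. *)
Lemma obstruction_unique (E : principal_bundle G B) (s s' : disk R -> E) C C' :
  continuous s -> continuous s' -> (forall x, gproj (s x) = gproj (s' x)) ->
  edge_lift s C -> edge_lift s' C' -> obstruction C = obstruction C'.
Proof.
move=> cs cs' ss' sC sC'.
have actM (e : E) g k : @gact _ _ E e (g * k)%g = gact (gact e g) k.
  by have [_ _ []] := bundleP E.
have [u cu su] := principal_division cs cs' ss'.
have [U cU pU] : exists2 U : disk R -> Gt, continuous U & forall x, p (U x) = u x.
  have [_ p_surj _] := p_cov.
  have [g0 pg0] := p_surj (u (disk_center R)).
  (* Contracting the disk to its centre joins [u] to a constant map, so [u] lifts. *)
  pose v (y : R * disk R) := u (segment (clamp y.1) (disk_center R) y.2).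
  have cv : continuous v.
    apply: (continuousT_comp cu); apply: segment_continuous.
    - exact: continuousT_comp (@clamp_continuous R) (@continuous_fst _ _).
    - exact: cst_continuous.
    - exact: continuous_snd.
  have [|U cU pU] := lift_contraction (@disk_compact R) pM p_cov cv (g0 := g0).
    by move=> x; rewrite /v/= segment0.
  by exists U => // x; rewrite pU /v/= segment1.
pose Ub r := U (boundary h r).
have cUb : continuous Ub := continuousT_comp cU (@boundary_continuous R h).
have ker_central z : p z = 1%g -> forall g, (z * g = g * z)%g.
  exact: (@covering_ker_central R).
have zP k : (k < 4 * h)%N -> (k %% 4 < 2)%N ->
  exists2 z, p z = 1%g &
    (C k 0%R * Ub (k + 3)%:R = Ub k%:R * C' k 0%R * z)%g /\
    (C k 1%R * Ub (k + 2)%:R = Ub (k + 1)%:R * C' k 1%R * z)%g.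
  move=> k1 k2.
  (* [w] measures how far the lifts are from satisfying the relation that holds in [G]. It stays in
     the kernel, hence is constant, so the same [z] serves both ends of the side. *)
  pose w t := ((Ub (k%:R + t)%R * C' k t)^-1 *
     (C k t * Ub ((k + 2)%:R + (1 - t))%R))%g.
  have pw t : 0 <= t <= 1 -> p (w t) = 1%g.
    move=> t01; rewrite /w pM (group_homV pM) !pM /Ub !pU.
    apply/eqP; rewrite mulg_eq1 eqg_inv; apply/eqP.
    apply: (@principal_act_free _ _ E (s (boundary h (k%:R + t)))).
    by rewrite !actM -su -(proj2 sC') -?(proj2 sC)// su.
  have cw : continuous w.
    apply: continuousMg; [apply: continuousVg|]; apply: continuousMg.
    - apply: (continuousT_comp cUb).
      apply: continuousRD; first exact: cst_continuous.
      by move=> t; exact: cvg_id.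
    - exact: (proj1 sC').
    - exact: (proj1 sC).
    - apply: (continuousT_comp cUb).
      apply: continuousRD; first exact: cst_continuous.
      apply: continuousRB; first exact: cst_continuous.
      by move=> t; exact: cvg_id.
  have w01 := covering_ker_itv pM p_cov cw pw.
  exists (w 0); first by rewrite pw// lexx ler01.
  split; first by rewrite /w corner0 addr0 mulVKg.
  by rewrite w01 /w corner1 (natrD _ k 1) mulVKg.
have H n : (n <= h)%N ->
    ((\prod_(0 <= i < n) handle_word C i) * Ub (4 * n)%:R =
     Ub 0%R * \prod_(0 <= i < n) handle_word C' i)%g.
  elim: n => [_|n IHn nh]; first by rewrite !big_nil muln0 mulg1 mul1g.
  have [a1 a2 b1 b2] := handle_sides nh.
  have [a pa [A0 A1]] := zP _ a1 a2; have [b pb [B0 B1]] := zP _ b1 b2.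
  rewrite !big_nat_recr//= [RHS]mulgA -IHn 1?ltnW//
    -!(mulgA (\prod_(0 <= i < n) _)%g); congr (_ * _)%g.
  rewrite (_ : 4 * n + 1 + 3 = 4 * n.+1)%N in B0; last by lia.
  rewrite (_ : 4 * n + 1 + 2 = 4 * n + 3)%N in B1; last by lia.
  rewrite (_ : 4 * n + 1 + 1 = 4 * n + 2)%N in B1; last by lia.
  exact: handle_telescope (ker_central _ pa) (ker_central _ pb) A0 A1 B0 B1.
(* Corner [4 h] is corner 0, so the two obstructions are conjugate by [Ub 0], and they are
   central. *)
have := H h (leqnn h); rewrite -/(obstruction C) -/(obstruction C').
rewrite /Ub boundary_period// (ker_central _ (obstruction_pi1 sC)).
exact: mulgI.
Qed.

End obstruction.

(** * Bundles with prescribed obstruction *)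

(** The name is indexed by [U] and [tau] because the topology put on this product depends on them
    and is not the product topology. *)
Definition clutching (G : topologicalGroupType) (B : topologicalType) (J : Type)
  (U : J -> set B) (tau : J -> B -> G) : Type := (B * G)%type.

Section clutching.
Context (G : topologicalGroupType) (B : topologicalType).
Context (J : Type) (U : J -> set B) (tau : J -> B -> G).

Local Notation clutching := (clutching U tau).

HB.instance Definition _ := Choice.on clutching.

(* The total space is the product as a set, and carries the topology for which
   [(b, g) |-> (b, tau i b * g)] is a chart over [U i].  Only the transition
   functions [tau i ^-1 * tau j] have to be continuous. *)
Definition clutching_chart (i : J) (z : B * G) : clutching :=
  (z.1, tau i z.1 * z.2)%g.

Definition clutching_coord (i : J) (z : clutching) : B * G :=
  (z.1, (tau i z.1)^-1 * z.2)%g.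

Definition clutching_open (O : set clutching) : Prop :=
  forall i z, U i z.1 -> O (clutching_chart i z) ->
    nbhs z (clutching_chart i @^-1` O).

Lemma clutching_openT : clutching_open setT.
Proof. by move=> i z _ _; exact: filterT. Qed.

Lemma clutching_openI : setI_closed clutching_open.
Proof.
by move=> O P oO oP i z Uz [Oz Pz]; apply: filterI; [exact: oO|exact: oP].
Qed.

Lemma clutching_open_bigU (K : Type) (f : K -> set clutching) :
  (forall k, clutching_open (f k)) -> clutching_open (\bigcup_k f k).
Proof.
move=> of_ i z Uz [k _ fkz]; apply: filterS (of_ k i z Uz fkz) => y fy.
by exists k.
Qed.

HB.instance Definition _ := isOpenTopological.Build clutching
  clutching_openT clutching_openI clutching_open_bigU.

Lemma clutching_chartK i : cancel (clutching_chart i) (clutching_coord i).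
Proof. by case=> b g; rewrite /clutching_coord/= mulKg. Qed.

Lemma clutching_coordK i : cancel (clutching_coord i) (clutching_chart i).
Proof. by case=> b g; rewrite /clutching_chart/= mulVKg. Qed.

Lemma clutching_chart_continuous i z : U i z.1 ->
  {for z, continuous (clutching_chart i)}.
Proof.
move=> Uz A; rewrite nbhsE => -[W [oW Wz] WA].
by apply: filterS (oW i z Uz Wz) => y; exact: WA.
Qed.

Hypothesis U_open : forall i, open (U i).
Hypothesis U_cover : forall b, exists i, U i b.
Hypothesis tau_continuous : forall i j b, U i b -> U j b ->
  {for b, continuous (fun b => (tau i b)^-1 * tau j b)%g}.

Lemma clutching_coord_continuous i (z : clutching) : U i z.1 ->
  {for z, continuous (clutching_coord i)}.
Proof.
move=> Uz A; rewrite nbhsE => -[W [oW Wz] WA].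
(* Openness of [O] is tested in every chart [j], where the change of charts is multiplication by the
   transition function. *)
pose O : set clutching := [set y | U i y.1 /\ W (clutching_coord i y)].
have oO : open O.
  move=> j y Ujy [/= Uiy Wy].
  pose f (x : B * G) := clutching_coord i (clutching_chart j x).
  have cf : {for y, continuous f}.
    apply: cvg_pair; first exact: cvg_fst.
    rewrite /f/=; under eq_fun do rewrite mulgA.
    rewrite mulgA; apply: cvgMg; last exact: cvg_snd.
    apply: (@continuous_comp _ _ _ fst (fun b => (tau i b)^-1 * tau j b)%g).
      exact: continuous_fst.
    exact: tau_continuous.
  apply: filterI; last exact: cf (open_nbhs_nbhs (conj oW Wy)).
  exact: (@continuous_fst B G y _ (open_nbhs_nbhs (conj (U_open i) Uiy))).
have : nbhs z O by exact: open_nbhs_nbhs.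
by apply: filterS => y [_]; exact: WA.
Qed.

Definition clutching_gspace : gspace G B :=
  @GSpace G B clutching (fun z => z.1) (fun z k => (z.1, z.2 * k)%g).

Lemma clutching_principal : is_principal clutching_gspace.
Proof.
have cproj : continuous (@gproj _ _ clutching_gspace).
  move=> z; have [i Uz] := U_cover z.1.
  apply: (@continuous_comp _ _ _ (clutching_coord i) fst).
    exact: clutching_coord_continuous.
  exact: continuous_fst.
split=> //.
- move=> [z k]; have [i Uz] := U_cover z.1.
  pose m (y : (B * G) * G) := (y.1.1, (y.1.2 * y.2)%g).
  pose c (y : clutching * G) := (clutching_coord i y.1, y.2).
  have -> : (fun eg : clutching_gspace * G => gact eg.1 eg.2) =
      (clutching_chart i \o (m \o c)).
    apply/funext => -[[b g] g'] /=.
    by rewrite /clutching_chart/= mulgA mulVKg.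
  have cc : {for (z, k), continuous c}.
    apply: (@continuous_pair _ _ _ (fun y => clutching_coord i y.1) snd).
      apply: (@continuous_comp _ _ _ fst (clutching_coord i)).
        exact: continuous_fst.
      exact: clutching_coord_continuous.
    exact: continuous_snd.
  have cm : continuous m.
    have c1 := @continuous_fst (B * G)%type G.
    apply: continuousT_pair; first exact: continuousT_comp (@continuous_fst B G) c1.
    apply: continuousMg; last exact: continuous_snd.
    exact: continuousT_comp (@continuous_snd B G) c1.
  have cmc : {for (z, k), continuous (m \o c)}.
    by apply: continuous_comp; [exact: cc|exact: cm].
  apply: (@continuous_comp _ _ _ (m \o c) (clutching_chart i)).
    exact: cmc.
  exact: clutching_chart_continuous.
- by split=> [[b g]|[b g] k l]; rewrite /gact/= ?mulg1 ?mulgA.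
- move=> b; have [i Ub] := U_cover b; exists (U i); split => //.
  exists (clutching_coord i), (clutching_chart i); split.
  + split; apply: continuous_in_subspaceT => z /set_mem /=.
      exact: clutching_coord_continuous.
    by move=> [Uz _]; exact: clutching_chart_continuous.
  + by move=> e _; exact: clutching_coordK.
  + by move=> b' g _; rewrite clutching_chartK.
  + by [].
  + by move=> e g _; rewrite /clutching_coord/= mulgA.
Qed.

Definition clutching_bundle : principal_bundle G B :=
  PrincipalBundle clutching_principal.

End clutching.

(** * A loop in the group spread around the origin, and its lift *)

Section angular_coordinate.
Context (R : realType).
Implicit Types z : R * R.

(* Runs from 0 to 1 as the upper unit half-circle is traversed
   counterclockwise. *)
Definition half_turn z : R := (1 - z.1 / (`|z.1| + `|z.2|)) / 2.

Lemma norm1_neq0 z : z != (0, 0) -> `|z.1| + `|z.2| != 0.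
Proof.
apply: contra; rewrite paddr_eq0// !normr_eq0 => /andP[/eqP z1 /eqP z2].
by case: z z1 z2 => x y /= -> ->.
Qed.

Lemma half_turn_continuous z : z != (0, 0) -> {for z, continuous half_turn}.
Proof.
move=> z0; apply: (@cvgM R); last exact: cvg_cst.
apply: (@cvgB R R); first exact: cvg_cst.
apply: (@cvgM R); first exact: cvg_fst.
apply: (@cvgV R); first exact: norm1_neq0.
by apply: (@cvgD R R); apply: (@cvg_norm R R); [exact: cvg_fst|exact: cvg_snd].
Qed.

Lemma half_turn_axis z : z != (0, 0) -> z.2 = 0 ->
  half_turn z = 0 \/ half_turn z = 1.
Proof.
case: z => x y /= xy0 y0; move: xy0; rewrite /half_turn/= y0 normr0 addr0.
rewrite xpair_eqE eqxx andbT => x0.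
have [xge|xlt] := leP 0 x; [left|right].
  by rewrite ger0_norm// divff// subrr mul0r.
by rewrite ltr0_norm// invrN mulrN divff// opprK divff.
Qed.

Context (G : topologicalGroupType) (P : R -> G).
Hypotheses (P_continuous : continuous P) (P0 : P 0 = 1%g) (P1 : P 1 = 1%g).

Definition radial_loop z : G := if z.2 <= 0 then 1%g else P (half_turn z).

(** On the horizontal axis away from the origin [half_turn] is 0 or 1, and [P] is 1 at both, so the
    two branches match. *)
Lemma radial_loop_continuous z : z != (0, 0) ->
  {for z, continuous radial_loop}.
Proof.
move=> z0.
have cPh : {for z, continuous (P \o half_turn)}.
  by apply: continuous_comp; [exact: half_turn_continuous|exact: P_continuous].
move=> N Nz; change (nbhs z (radial_loop @^-1` N)).
have [z2|z2|z2] := ltgtP z.2 0.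
- have z2N : \forall y \near z, y.2 < 0.
    by apply: (@continuous_snd R R z [set y : R | y < 0]); apply: open_nbhs_nbhs.
  apply: filterS z2N => y y0; rewrite /= /radial_loop/= ltW//.
  by move: (nbhs_singleton Nz); rewrite /= /radial_loop ltW.
- have z2N : \forall y \near z, 0 < y.2.
    by apply: (@continuous_snd R R z [set y : R | 0 < y]); apply: open_nbhs_nbhs.
  have Ny : \forall y \near z, N (P (half_turn y)).
    by apply: cPh; move: Nz; rewrite /radial_loop leNgt z2.
  by apply: filterS2 z2N Ny => y y0; rewrite /= /radial_loop leNgt y0.
- have Pz : P (half_turn z) = 1%g by case: (half_turn_axis z0 z2) => ->.
  have N1 : nbhs (1%g : G) N by move: Nz; rewrite /radial_loop z2 lexx.
  have Ny : \forall y \near z, N (P (half_turn y)) by apply: cPh; rewrite /= Pz.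
  apply: filterS Ny => y Ny; rewrite /= /radial_loop; case: ifP => // _.
  exact: nbhs_singleton N1.
Qed.

Context (Gt : topologicalGroupType) (p : Gt -> G) (Q : R -> Gt) (g : Gt).
Hypotheses (Q_continuous : continuous Q) (Q0 : Q 0 = 1%g) (Q1 : Q 1 = g).
Hypotheses (pQ : forall t, p (Q t) = P t).
Context (h : nat) (h_gt0 : (0 < h)%N).

(** The lift of [radial_loop] along the polygon: the upper half, [r] from 0 to [2 h], follows [Q];
    on the lower half the loop is trivial but its lift stays at [g]. It is not periodic, and gains
    [g] in one turn. *)
Definition loop_lift (r : R) : Gt :=
  if r <= (2 * h)%:R then Q (half_turn (boundary_point h r)) else g.

Lemma boundary_point_neq0 r : boundary_point h r != (0 : R, 0 : R).
Proof.
apply/eqP => -[c0 s0].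
have := cos2Dsin2 (2 * pi * r / (4 * h)%:R : R).
by rewrite c0 s0 expr0n addr0 => /eqP; rewrite eq_sym oner_eq0.
Qed.

Lemma half_angle : 2 * pi * (2 * h)%:R / (4 * h)%:R = pi :> R.
Proof.
rewrite !natrM; have : h%:R != 0 :> R by rewrite pnatr_eq0 -lt0n.
by move=> h0; field.
Qed.

Lemma half_turn_end : half_turn (boundary_point h (2 * h)%:R) = 1.
Proof.
rewrite /half_turn/boundary_point/= half_angle cospi sinpi normrN normr0 normr1.
by rewrite addr0 divr1 opprK divff.
Qed.

Lemma half_turn_start : half_turn (boundary_point h 0) = 0.
Proof.
rewrite /half_turn/boundary_point/= mulr0 mul0r cos0 sin0 normr0 normr1.
by rewrite addr0 divr1 subrr mul0r.
Qed.

Lemma loop_lift_continuous : continuous loop_lift.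
Proof.
apply: continuous_paste; last by move=> _ ->; rewrite half_turn_end.
- by move=> r; exact: cvg_id.
- apply: (continuousT_comp Q_continuous) => r.
  apply: (@continuous_comp _ _ _ (@boundary_point R h)).
    exact: (continuousT_comp (@disk_val_continuous R) (@boundary_continuous R h)).
  exact/half_turn_continuous/boundary_point_neq0.
- exact: cst_continuous.
Qed.

Lemma loop_lift_start : loop_lift 0 = 1%g.
Proof. by rewrite /loop_lift ler0n half_turn_start Q0. Qed.

Lemma loop_lift_end : loop_lift (4 * h)%:R = g.
Proof.
by rewrite /loop_lift ler_nat ifF//; apply/negbTE; rewrite -ltnNge; lia.
Qed.

Lemma loop_liftE r : 0 <= r <= (4 * h)%:R ->
  p (loop_lift r) = radial_loop (boundary_point h r).
Proof.
move=> /andP[r0 r4]; have h4 : 0 < (4 * h)%:R :> R by rewrite ltr0n muln_gt0.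
have pr0 : 0 <= 2 * pi * r :> R by rewrite !mulr_ge0// pi_ge0.
rewrite /loop_lift; case: ifPn => r2.
  rewrite pQ /radial_loop; case: ifPn => // s0.
  (* On the first half the sine is nonnegative, so this branch occurs only on the axis, where [P] is
     1. *)
  have {}s0 : (boundary_point h r).2 = 0.
    apply/eqP; rewrite eq_le s0/=; apply: sin_ge0_pi.
    rewrite divr_ge0//= -[leRHS]half_angle ler_pM2r ?invr_gt0// ler_wpM2l//.
    by rewrite mulr_ge0// pi_ge0.
  by have [->|->] := half_turn_axis (boundary_point_neq0 r) s0.
rewrite /radial_loop ifT; first by rewrite -Q1 pQ P1.
(* On the second half the angle is [pi] plus an angle between 0 and [pi]. *)
rewrite /boundary_point/= -[_ / _](subrK pi) sinDpi oppr_le0.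
have -> : 2 * pi * r / (4 * h)%:R - pi = 2 * pi * (r - (2 * h)%:R) / (4 * h)%:R.
  by rewrite -[in X in _ - X]half_angle -mulrBl -mulrBr.
move: r2; rewrite -ltNge => r2; apply: sin_ge0_pi; apply/andP; split.
  by rewrite !mulr_ge0 ?invr_ge0 ?pi_ge0 ?subr_ge0// ltW.
rewrite -[leRHS]half_angle ler_pM2r ?invr_gt0// ler_wpM2l ?mulr_ge0 ?pi_ge0//.
by rewrite lerBlDr -natrD (le_trans r4)// ler_nat; lia.
Qed.

End angular_coordinate.

(** * The surface as a quotient of the polygon, and clutching at its centre *)

Section surface_parametrization.
Context (R : realType) (h : nat) (S : topologicalType).

Definition disk_interior : set (disk R) :=
  [set x | (disk_val x).1 ^+ 2 + (disk_val x).2 ^+ 2 < 1].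

Record parametrization (q : disk R -> S) : Prop := Parametrization {
  param_continuous : continuous q;
  param_surj : forall b, exists x, q x = b;
  param_open : forall A : set S, open (q @^-1` A) -> open A;
  param_glue : forall (k : nat) (t : R), (k < 4 * h)%N -> (k %% 4 < 2)%N ->
    0 <= t <= 1 ->
    q (boundary h (k%:R + t)) = q (boundary h ((k + 2)%:R + (1 - t)));
  param_inj : forall x y, disk_interior x -> q x = q y -> x = y
}.

Lemma surface_parametrization : closed_oriented_surface R h S ->
  exists q, parametrization q.
Proof.
move=> [f [g [cf cg fK gK]]]; exists (fun x => g (\pi_(surface R h) x)); split.
- exact: continuousT_comp cg (@pi_continuous _ _).
- by move=> b; exists (repr (f b)); rewrite reprK fK.
- move=> A oA.
  have -> : A = f @^-1` (g @^-1` A) by apply/seteqP; split => b /=; rewrite fK.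
  by move/continuousP : cf; apply.
- move=> k t k4 k2 t01; congr g; apply/gen_equivP; apply: rst_step.
  by exists k, t; split.
- move=> x y x1 /(can_inj gK) /gen_equivP xy.
  (* An invariant of the generated equivalence: gluing only relates boundary points. *)
  have : disk_interior x /\ x = y \/ ~ disk_interior x /\ ~ disk_interior y.
    elim: xy {x1} => {x y} [x y [k [t [_ _ _ xb yb]]]|x|x y _ IH|x y z _ xy _ yz].
    + by right; rewrite /disk_interior/= xb yb /= !cos2Dsin2 ltxx.
    + by have [|] := pselect (disk_interior x); [left|right].
    + by case: IH => [[x1 <-]|[x1 y1]]; [left|right].
    + case: xy yz => [[x1 ->]//|[x1 y1]] [[y1' _]//|[_ z1]].
      by right.
  by case=> -[].
Qed.

Context (q : disk R -> S) (q_param : parametrization q).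

Lemma disk_interior_open : open disk_interior.
Proof.
have sqrc : continuous (fun r : R => r ^+ 2) := @exprn_continuous R 2.
have cn : continuous
    (fun x : disk R => (disk_val x).1 ^+ 2 + (disk_val x).2 ^+ 2).
  have cv := @disk_val_continuous R.
  apply: continuousRD; apply: (continuousT_comp sqrc).
    exact: continuousT_comp (@continuous_fst _ _) cv.
  exact: continuousT_comp (@continuous_snd _ _) cv.
by move/continuousP : cn => /(_ _ (@open_lt R 1)).
Qed.

Lemma param_image_open (W : set (disk R)) : open W -> W `<=` disk_interior ->
  open (q @` W).
Proof.
move=> oW Wint; apply: (param_open q_param).
suff -> : q @^-1` (q @` W) = W by [].
apply/seteqP; split => [x [y Wy /(param_inj q_param (Wint _ Wy)) <-]//|x Wx].
by exists x.
Qed.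

Lemma disk_center_interior : disk_interior (disk_center R).
Proof. by rewrite /disk_interior/= expr0n addr0. Qed.

Lemma disk_neq_center_val (x : disk R) :
  x <> disk_center R -> disk_val x != (0, 0).
Proof. by move=> x0; apply/eqP => x00; apply: x0; exact: disk_val_inj. Qed.

Lemma param_center_open : open (~` [set q (disk_center R)]).
Proof.
apply: (param_open q_param).
have -> : q @^-1` (~` [set q (disk_center R)]) = @disk_val R @^-1` (~` [set (0, 0)]).
  apply/seteqP; split => x /= x0.
    move=> xc; apply: x0; congr q; exact: disk_val_inj.
  move=> /esym/(param_inj q_param disk_center_interior) xc.
  by apply: x0; rewrite -xc.
move/continuousP : (@disk_val_continuous R); apply.
have -> : ~` [set ((0, 0) : R * R)] = [set z | 0 < `|z.1| + `|z.2|].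
  apply/seteqP; split => -[x y] /=; last by
    move=> /[swap] -[-> ->]; rewrite normr0 addr0 ltxx.
  by move/eqP/norm1_neq0; rewrite lt0r => ->/=; rewrite addr_ge0.
have cn : continuous (fun z : R * R => `|z.1| + `|z.2|).
  apply: continuousRD; apply: (continuousT_comp (@norm_continuous R R)).
    exact: continuous_fst.
  exact: continuous_snd.
by move/continuousP : cn => /(_ _ (@open_gt R 0)).
Qed.

Context (G : topologicalGroupType) (lam : disk R -> G).
Hypothesis lam_continuous : forall x, x <> disk_center R ->
  {for x, continuous lam}.

Definition punctured_chart (i : bool) : set S :=
  if i then ~` [set q (disk_center R)] else q @` disk_interior.

(** On the chart [false], [lam] is read off at the unique interior preimage, so the default of
    [xget] is never taken there. A discontinuity of [lam] at the centre is harmless, since the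
    overlap of the charts omits the centre. *)
Definition punctured_tau (i : bool) (b : S) : G :=
  if i then 1%g
  else lam (xget (disk_center R) [set x | disk_interior x /\ q x = b]).

Arguments punctured_tau : simpl never.

Lemma punctured_tauE x : disk_interior x -> punctured_tau false (q x) = lam x.
Proof.
move=> x1; rewrite /punctured_tau; congr lam.
case: xgetP => [y _ [y1 qyx]|/(_ x)]; first exact: (param_inj q_param).
by move=> /(_ (conj x1 erefl)).
Qed.

Lemma punctured_chart_open i : open (punctured_chart i).
Proof.
case: i; first exact: param_center_open.
exact: param_image_open disk_interior_open _.
Qed.

Lemma punctured_chart_cover b : exists i, punctured_chart i b.
Proof.
have [bc|bc] := pselect (b = q (disk_center R)); last by exists true.
by exists false, (disk_center R) => //; exact: disk_center_interior.
Qed.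

Lemma punctured_tau_continuous i j b :
  punctured_chart i b -> punctured_chart j b ->
  {for b, continuous (fun b => (punctured_tau i b)^-1 * punctured_tau j b)%g}.
Proof.
have ctau b' : punctured_chart true b' -> punctured_chart false b' ->
    {for b', continuous (punctured_tau false)}.
  move=> b0 [x x1 xb]; rewrite -xb in b0 *.
  have x0 : x <> disk_center R by move=> xc; apply: b0; rewrite xc.
  move=> N; rewrite /= punctured_tauE// => /(lam_continuous x0) Nx.
  have : nbhs x (lam @^-1` N `&` disk_interior).
    apply: filterI => //; apply: open_nbhs_nbhs; split => //.
    exact: disk_interior_open.
  rewrite nbhsE => -[W [oW Wx] WN].
  have : nbhs (q x) (q @` W).
    apply: open_nbhs_nbhs; split; last by exists x.
    by apply: param_image_open => // y /WN[].
  by apply: filterS => _ [y /WN[Ny y1] <-]; rewrite /= punctured_tauE.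
have ctrue b' : {for b', continuous (punctured_tau true)} by exact: cvg_cst.
have cself k : (fun b => (punctured_tau k b)^-1 * punctured_tau k b)%g = cst 1%g.
  by apply/funext => b'; rewrite mulVg.
case: i j => -[] b1 b2; last first.
- by rewrite cself; exact: cvg_cst.
- by apply: cvgMg; [apply: cvgVg; exact: ctau|exact: ctrue].
- by apply: cvgMg; [apply: cvgVg; exact: ctrue|exact: ctau].
- by rewrite cself; exact: cvg_cst.
Qed.

Definition disk_bundle : principal_bundle G S :=
  clutching_bundle punctured_chart_open punctured_chart_cover
    punctured_tau_continuous.

Definition disk_section (x : disk R) : disk_bundle := (q x, lam x).

(** In the chart [true] the fibre coordinate is [lam], continuous off the centre; in the chart
    [false] it is constantly 1 near the centre. *)
Lemma disk_section_continuous : continuous disk_section.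
Proof.
move=> x; have [->|x0] := pselect (x = disk_center R); last first.
  have -> : disk_section =
      @clutching_chart G S bool punctured_chart punctured_tau true \o
      (fun x => (q x, lam x)).
    by apply/funext => y; rewrite /clutching_chart/= mul1g.
  apply: continuous_comp.
    by apply: continuous_pair; [exact: param_continuous|exact: lam_continuous].
  apply: clutching_chart_continuous => /= /esym.
  by move/(param_inj q_param disk_center_interior)/esym.
set c := disk_center R.
pose k := @clutching_chart G S bool punctured_chart punctured_tau false \o
  (fun x => (q x, 1%g : G)).
have ck : {for c, continuous k}.
  apply: continuous_comp.
    by apply: continuous_pair; [exact: param_continuous|exact: cst_continuous].
  apply: clutching_chart_continuous => /=.
  by exists c; first exact: disk_center_interior.
have kN : \forall y \near c, k y = disk_section y.
  have : nbhs c disk_interior.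
    apply: open_nbhs_nbhs; split; first exact: disk_interior_open.
    exact: disk_center_interior.
  apply: filterS => y y1.
  by rewrite /k/= /clutching_chart/= mulg1 punctured_tauE.
rewrite /continuous_at -(nbhs_singleton kN).
by apply: cvg_trans (near_eq_cvg kN) _.
Qed.

End surface_parametrization.

Lemma bundle_with_obstruction (R : realType) (h : nat) (S : topologicalType)
    (q : disk R -> S) (G Gt : topologicalGroupType) (p : Gt -> G) (g : Gt) :
  parametrization h q -> (0 < h)%N -> {morph p : x y / (x * y)%g} ->
  continuous p -> path_connected R [set: Gt] -> p g = 1%g ->
  exists (E : principal_bundle G S) (s : disk R -> E) (C : nat -> R -> Gt),
    [/\ continuous s, forall x, gproj (s x) = q x, edge_lift p h s C &
        obstruction h C = g].
Proof.
move=> q_param h_gt0 pM cp Gt_pc pg.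
have [_ /(_ 1%g g I I)[a _]] := Gt_pc.
pose Q (t : R) := a (clamp t).
have cQ : continuous Q := continuousT_comp (@cts_fun _ _ a) (@clamp_continuous R).
have Q0 : Q 0 = 1%g by exact: path_zero.
have Q1 : Q 1 = g by exact: path_one.
pose P t := p (Q t).
have cP : continuous P := continuousT_comp cp cQ.
have P0 : P 0 = 1%g by rewrite /P Q0 (group_homM1 pM).
have P1 : P 1 = 1%g by rewrite /P Q1.
pose lam (x : disk R) := radial_loop P (disk_val x).
have clam x : x <> disk_center R -> {for x, continuous lam}.
  move=> x0; apply: (@continuous_comp _ _ _ (@disk_val R) (radial_loop P)).
    exact: disk_val_continuous.
  by apply: radial_loop_continuous => //; exact: disk_neq_center_val.
pose L := loop_lift Q g h.
have cL : continuous L by exact: loop_lift_continuous.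
(* The section is [lam] in the fibre, so its jump is a quotient of values of [lam] on the boundary,
   which [L] lifts. *)
pose C (k : nat) (t : R) := ((L (k%:R + t)%R)^-1 * L ((k + 2)%:R + (1 - t))%R)%g.
exists (disk_bundle q_param clam), (disk_section q_param clam), C; split.
- exact: disk_section_continuous.
- by [].
- split=> [k|k t k4 k2 t01].
    have ct : continuous (fun t : R => t) by move=> t; exact: cvg_id.
    apply: continuousMg; [apply: continuousVg|]; apply: (continuousT_comp cL).
      by apply: continuousRD => //; exact: cst_continuous.
    by apply: continuousRD; [|apply: continuousRB => //]; exact: cst_continuous.
  have pL r : 0 <= r <= (4 * h)%:R -> p (L r) = lam (boundary h r).
    by move=> r4; rewrite /L (@loop_liftE _ _ P)// boundaryE.
  rewrite /disk_section [RHS]/gact/= (param_glue q_param k4 k2 t01).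
  move: t01 => /andP[t0 t1].
  rewrite /C pM (group_homV pM) !pL ?mulVKg//; apply/andP; split.
  + by rewrite addr_ge0 ?ler0n// subr_ge0.
  + rewrite (@le_trans _ _ (k + 3)%:R) ?ler_nat; [by []| |by lia].
    by rewrite -corner0 lerD2l subr0 gerBl.
  + by rewrite addr_ge0.
  + rewrite (@le_trans _ _ (k + 1)%:R) ?ler_nat; [by []| |by lia].
    by rewrite natrD lerD2l.
- have L0 : L 0 = 1%g by exact: loop_lift_start.
  have L4 : L (4 * h)%:R = g by exact: loop_lift_end.
  rewrite -[RHS]L4 -[RHS]mul1g -invg1 -L0.
  (* Only the number of factors varies; [L] keeps the original [h]. The product telescopes to the
     quotient of the values of [L] at [4 n] and 0. *)
  elim: (h) => [|n IHn]; first by rewrite /obstruction big_nil muln0 mulVg.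
  rewrite /obstruction big_nat_recr//= -/(obstruction n C) IHn /handle_word /C.
  rewrite !corner0 !corner1 !addr0 -!(natrD _ _ 1) !invgM !invgK !mulgA.
  rewrite (_ : 4 * n + 1 + 2 = 4 * n + 3)%N; last by lia.
  rewrite (_ : 4 * n + 1 + 1 = 4 * n + 2)%N; last by lia.
  rewrite (_ : 4 * n + 1 + 3 = 4 * n.+1)%N; last by lia.
  by rewrite !mulgK.
Qed.

(** * Foliated bundles *)

Section path_homotopies.
Context (R : realType) (T : topologicalType).
Local Notation I := (I01 R).

Lemma I01_val0 : I01_val (zero : I) = 0.
Proof. by rewrite -[zero]/(clamp 0) val_clamp ?lexx ?ler01. Qed.

Lemma I01_val1 : I01_val (one : I) = 1.
Proof. by rewrite -[one]/(clamp 1) val_clamp ?lexx ?ler01. Qed.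

Lemma half_lt1 : (1 <= 2^-1 :> R) = false.
Proof. by apply/negbTE; rewrite -ltNge; lra. Qed.

Lemma double1B1 : 2 * 1 - 1 = 1 :> R.
Proof. by lra. Qed.

Lemma homotopic_factor (V : topologicalType) (seg : I -> V -> V -> V)
    (f : V -> T) (a b : I -> V) :
  (forall (X : topologicalType) (t : X -> I) (x y : X -> V), continuous t ->
    continuous x -> continuous y -> continuous (fun z => seg (t z) (x z) (y z))) ->
  (forall x y, seg zero x y = x) -> (forall x y, seg one x y = y) ->
  (forall t x, seg t x x = x) ->
  continuous f -> continuous a -> continuous b ->
  a zero = b zero -> a one = b one ->
  path_homotopic (fun t => f (a t)) (fun t => f (b t)).
Proof.
move=> cseg seg0 seg1 segxx cf ca cb ab0 ab1.
exists (fun z : I * I => f (seg z.2 (a z.1) (b z.1))); split => [|t|t|s|s] /=.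
- apply: (continuousT_comp cf); apply: cseg; first exact: continuous_snd.
    exact: continuousT_comp ca (@continuous_fst _ _).
  exact: continuousT_comp cb (@continuous_fst _ _).
- by rewrite seg0.
- by rewrite seg1.
- by rewrite -ab0 segxx.
- by rewrite -ab1 segxx.
Qed.

Lemma homotopic_disk (f : disk R -> T) (a b : I -> disk R) :
  continuous f -> continuous a -> continuous b ->
  a zero = b zero -> a one = b one ->
  path_homotopic (fun t => f (a t)) (fun t => f (b t)).
Proof.
apply: (@homotopic_factor _ (@segment R)).
- by move=> X t x y ct cx cy; exact: segment_continuous.
- by move=> x y; exact: segment0.
- by move=> x y; exact: segment1.
- move=> t x; apply: disk_val_inj; rewrite disk_valK /combination -!mulrDl subrK.
  by rewrite !mul1r; case: (disk_val x).
Qed.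

Lemma homotopic_line (f : R -> T) (a b : I -> R) :
  continuous f -> continuous a -> continuous b ->
  a zero = b zero -> a one = b one ->
  path_homotopic (fun t => f (a t)) (fun t => f (b t)).
Proof.
apply: (@homotopic_factor _ (fun t x y => (1 - I01_val t) * x + I01_val t * y)).
- move=> X t x y ct cx cy; have ct' := continuousT_comp (@val_I01_continuous R) ct.
  apply: continuousRD; apply: continuousRM => //.
  by apply: continuousRB => //; exact: cst_continuous.
- move=> x y; rewrite I01_val0.
  by rewrite subr0 mul1r mul0r addr0.
- move=> x y; rewrite I01_val1.
  by rewrite subrr mul1r mul0r add0r.
- by move=> t x; rewrite -mulrDl subrK mul1r.
Qed.

Lemma I01_val_itv (t : I) : 0 <= I01_val t <= 1.
Proof. by case: t => t /= /set_mem/=; rewrite in_itv. Qed.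

Lemma continuous_clamp (X : topologicalType) (u : X -> R) : continuous u ->
  continuous (fun x => clamp (u x)).
Proof. exact: continuousT_comp (@clamp_continuous R). Qed.

Lemma double_val_continuous (X : topologicalType) (t : X -> I) : continuous t ->
  continuous (fun x => 2 * I01_val (t x)).
Proof.
move=> ct; apply: continuousRM; first exact: cst_continuous.
exact: continuousT_comp (@val_I01_continuous R) ct.
Qed.

Lemma homotopic_concat_l (l c d : I -> T) : continuous l -> l one = c zero ->
  path_homotopic c d -> path_homotopic (concat l c) (concat l d).
Proof.
move=> cl lc [H [cH H0 H1 Hz Ho]].
exists (fun z : I * I => if I01_val z.1 <= 2^-1 then l (clamp (2 * I01_val z.1))
                 else H (clamp (2 * I01_val z.1 - 1), z.2)).
have cd := double_val_continuous (@continuous_fst I I).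
split=> [|t|t|s|s]; cbn [fst snd].
- apply: continuous_paste.
  + exact: continuousT_comp (@val_I01_continuous R) (@continuous_fst _ _).
  + exact: continuousT_comp cl (continuous_clamp cd).
  + apply: (continuousT_comp cH).
    apply: continuousT_pair; last exact: continuous_snd.
    by apply: continuous_clamp; apply: continuousRB => //; exact: cst_continuous.
  + move=> [t s] /= ->; rewrite mulfV ?pnatr_eq0// subrr -[clamp 0]/zero Hz.
    by rewrite -lc.
- by rewrite /concat H0.
- by rewrite /concat H1.
- by rewrite I01_val0 invr_ge0 ler0n mulr0 concat_zero.
- by rewrite I01_val1 half_lt1 double1B1 concat_one -[clamp 1]/one Ho.
Qed.

End path_homotopies.

(** * A section of an induced bundle with constant jumps *)

Section flat_section.
Context (R : realType) (S : topologicalType) (q : disk R -> S).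
Hypothesis q_continuous : continuous q.
Context (G : topologicalGroupType) (b0 : S) (rho : pi1_hom R b0 G).
Context (z0 : disk R) (qz0 : q z0 = b0).
Local Notation I := (I01 R).
Implicit Types x : disk R.

(** Segments start at [z0], some preimage of the base point and not necessarily the centre, so that
    their images start at [b0]. *)
Definition radial x (t : I) : S := q (segment t z0 x).

Lemma radial_continuous x : continuous (radial x).
Proof.
apply: (continuousT_comp q_continuous); apply: segment_continuous.
- by move=> t; exact: cvg_id.
- exact: cst_continuous.
- exact: cst_continuous.
Qed.

Lemma radial_zero x : radial x zero = b0.
Proof. by rewrite /radial segment0. Qed.

Lemma radial_one x : radial x one = q x.
Proof. by rewrite /radial segment1. Qed.

Definition radial_path x : {path I from b0 to q x in S} :=
  mk_path (@radial_continuous x) (radial_zero x) (radial_one x).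

Lemma pclassP (y y' : S) (c : {path I from b0 to y in S})
    (d : {path I from b0 to y' in S}) : path_homotopic c d -> pclass c = pclass d.
Proof. by move=> cd; apply/gen_equivP; exact: rst_step. Qed.

Lemma pclass_radial_continuous : continuous (fun x => pclass (radial_path x)).
Proof.
apply/continuousP => P oP; rewrite openE => x Px.
have [U [oU Ux UP]] := oP _ _ Px.
have : nbhs x (q @^-1` U).
  by apply: q_continuous; exact: open_nbhs_nbhs.
rewrite nbhsE => -[_ [[W oW <-] Wx] WU].
have /nbhs_ballP[e /= e0 eW] : nbhs (disk_val x) W by apply: open_nbhs_nbhs.
have Nx : nbhs x (@disk_val R @^-1` ball (disk_val x) e).
  exact: (@disk_val_continuous R x _ (nbhsx_ballx _ _ e0)).
apply: filterS Nx => y xy.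
pose d (t : I) := q (segment t x y).
have cseg (u v : disk R) : continuous (fun t : I => segment t u v).
  apply: segment_continuous; [|exact: cst_continuous|exact: cst_continuous].
  by move=> t; exact: cvg_id.
have cd : continuous d := continuousT_comp q_continuous (cseg x y).
have d0 : d zero = q x by rewrite /d segment0.
have d1 : d one = q y by rewrite /d segment1.
rewrite /=.
(* Both paths are images of paths in the convex disk with the same ends; this puts the class for [y]
   in the basic open set around the class for [x]. *)
have <- : pclass (pconcat (radial_path x) (mk_path cd d0 d1)) =
    pclass (radial_path y).
  apply: pclassP.
  pose w := concat (fun t : I => segment t z0 x) (fun t : I => segment t x y).
  have -> : pconcat (radial_path x) (mk_path cd d0 d1) =
      (fun t => q (w t)) :> (I -> S).
    apply/funext => t; change (concat (radial x) d t = q (w t)).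
    by rewrite /w /concat /radial /d; case: ifP.
  apply: homotopic_disk => //.
  - by apply: concat_continuous => //; rewrite segment1 segment0.
  - by rewrite /w concat_zero !segment0.
  - by rewrite /w concat_one !segment1.
apply: UP => t; apply: WU; apply: eW.
have /andP[t0 t1] := I01_val_itv t.
have tlt (u v : R) : `|u - v| < e ->
    `|u - ((1 - I01_val t) * u + I01_val t * v)| < e.
  have -> : u - ((1 - I01_val t) * u + I01_val t * v) = I01_val t * (u - v) by ring.
  by rewrite normrM (ger0_norm t0); apply: le_lt_trans; rewrite ler_piMl.
by case: xy => xy1 xy2; split; exact: tlt.
Qed.

Definition flat_section x : induced_bundle rho :=
  (\pi_(induced_total rho) (pclass (radial_path x), 1%g))%qT.

Lemma flat_section_continuous : continuous flat_section.
Proof.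
apply: (@continuousT_comp _ _ _ (\pi_(induced_total rho))%qT).
  exact: pi_continuous.
apply: continuousT_pair; first exact: pclass_radial_continuous.
exact: cst_continuous.
Qed.

Lemma flat_section_proj x : gproj (flat_section x) = q x.
Proof. by rewrite induced_projE ucover_projE. Qed.

Definition glue_loop_fun x x' : I -> S :=
  concat (radial x') (fun t => radial x (clamp (1 - I01_val t))).

Lemma reverse_continuous : continuous (fun t : I => clamp (1 - I01_val t)).
Proof.
apply: continuous_clamp; apply: continuousRB; first exact: cst_continuous.
exact: val_I01_continuous.
Qed.

Lemma reverse_zero : clamp (1 - I01_val (zero : I)) = one.
Proof. by rewrite I01_val0 subr0. Qed.

Lemma reverse_one : clamp (1 - I01_val (one : I)) = zero.
Proof. by rewrite I01_val1 subrr. Qed.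

Section glue_loop.
Context x x' (xx' : q x = q x').

Lemma glue_loop_continuous : continuous (glue_loop_fun x x').
Proof.
apply: concat_continuous; first exact: radial_continuous.
  exact: continuousT_comp (@radial_continuous x) reverse_continuous.
by rewrite reverse_zero !radial_one.
Qed.

Lemma glue_loop_zero : glue_loop_fun x x' zero = b0.
Proof. by rewrite /glue_loop_fun concat_zero radial_zero. Qed.

Lemma glue_loop_one : glue_loop_fun x x' one = b0.
Proof. by rewrite /glue_loop_fun concat_one reverse_one radial_zero. Qed.

Definition glue_loop : {path I from b0 to b0 in S} :=
  mk_path glue_loop_continuous glue_loop_zero glue_loop_one.

Lemma concat_glue_loop : path_homotopic (concat glue_loop (radial x)) (radial x').
Proof.
(* Both paths factor through the path [f] from [0] to [2] that follows
   [radial x'] and then [radial x] backwards. *)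
pose f (u : R) := if u <= 1 then radial x' (clamp u) else radial x (clamp (2 - u)).
(* [a] rises from 0 to 2 and returns to 1; the return is the cancelled backtracking along
   [radial x]. *)
pose a (t : I) :=
  if I01_val t <= 2^-1 then 2 * (2 * I01_val t) else 3 - 2 * I01_val t.
have cid (X : topologicalType) : continuous (@id X) by move=> t; exact: cvg_id.
have cf : continuous f.
  apply: continuous_paste.
  - exact: cid.
  - exact: continuousT_comp (@radial_continuous x') (@clamp_continuous R).
  - apply: (continuousT_comp (@radial_continuous x)); apply: continuous_clamp.
    by apply: continuousRB; [exact: cst_continuous|exact: cid].
  - move=> _ ->; rewrite (_ : 2 - 1 = 1 :> R); last by lra.
    by rewrite -[clamp 1]/one !radial_one.
have c2 := double_val_continuous (cid I).
have ca : continuous a.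
  apply: continuous_paste.
  - exact: val_I01_continuous.
  - by apply: continuousRM => //; exact: cst_continuous.
  - by apply: continuousRB => //; exact: cst_continuous.
  - by move=> t ->; lra.
have -> : concat glue_loop (radial x) = (fun t => f (a t)).
  apply/funext => t; have /andP[t0 t1] := I01_val_itv t.
  rewrite /f /a {1}/concat; case: ifPn => t2.
    rewrite -[LHS]/(glue_loop_fun x x' _) /glue_loop_fun /concat.
    rewrite val_clamp; last by apply/andP; split; lra.
    rewrite (_ : (2 * I01_val t <= 2^-1) = (2 * (2 * I01_val t) <= 1)); last first.
      by apply/idP/idP; lra.
    case: ifPn => // t4; congr radial; congr clamp.
    by rewrite val_clamp; [ring|apply/andP; split; lra].
  rewrite -ltNge in t2; case: ifPn => [t3|t3]; last first.
    by congr radial; congr clamp; ring.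
  have -> : I01_val t = 1 by lra.
  rewrite double1B1 (_ : 3 - 2 * 1 = 1 :> R); last by lra.
  by rewrite -[clamp 1]/one !radial_one.
have -> : radial x' = (fun t => f (I01_val t)).
  by apply/funext => t; rewrite /f; have /andP[_ ->] := I01_val_itv t;
    rewrite clamp_val.
apply: homotopic_line => //; first exact: val_I01_continuous.
  by rewrite /a I01_val0 invr_ge0 ler0n !mulr0.
by rewrite /a I01_val1 half_lt1; lra.
Qed.

Lemma loop_act_pclass (l : {path I from b0 to b0 in S}) (y : S)
    (c : {path I from b0 to y in S}) :
  loop_act l (pclass c) = pclass (pconcat l c).
Proof.
rewrite /loop_act /pclass; case: piP => r /gen_equivP rc.
(* [loop_act] uses a chosen representative, known only up to the generated equivalence. *)
suff H (c1 c2 : based_path R b0) :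
    clos_refl_sym_trans _ (@based_homotopic R S b0) c1 c2 ->
    pclass (pconcat l (tagged c1)) = pclass (pconcat l (tagged c2)).
  exact: esym (H _ _ rc).
elim=> {c1 c2} [c1 c2 c12|//|//|? ? ? _ -> _ ->//].
apply: pclassP; apply: homotopic_concat_l => //; first exact: cts_fun.
by rewrite path_one path_zero.
Qed.

(** The glue loop carries the class of [radial x] to that of [radial x'], and multiplies the fibre
    coordinate by its image under [rho]; the inverse compensates. *)
Lemma flat_section_glue :
  flat_section x' = gact (flat_section x) (rho glue_loop)^-1%g.
Proof.
rewrite induced_actE; apply/gen_equivP; apply: rst_sym; apply: rst_step.
exists glue_loop; rewrite /= mul1g mulgV loop_act_pclass; congr (_, _).
exact/esym/pclassP/concat_glue_loop.
Qed.

End glue_loop.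

(** Moving a glued pair moves its loop with ends fixed at [b0]; hence [rho] is constant along a
    side. *)
Lemma glue_loop_homotopic (X X' : I -> disk R)
    (XX' : forall s, q (X s) = q (X' s)) : continuous X -> continuous X' ->
  path_homotopic (glue_loop (XX' zero)) (glue_loop (XX' one)).
Proof.
move=> cX cX'.
exists (fun z : I * I => if I01_val z.1 <= 2^-1
  then radial (X' z.2) (clamp (2 * I01_val z.1))
  else radial (X z.2) (clamp (1 - I01_val (clamp (2 * I01_val z.1 - 1))))).
have cd := double_val_continuous (@continuous_fst I I).
have crad (Y : I * I -> disk R) (t : I * I -> I) : continuous Y -> continuous t ->
    continuous (fun z => radial (Y z) (t z)).
  move=> cY ct; apply: (continuousT_comp q_continuous).
  by apply: segment_continuous => //; exact: cst_continuous.
have cX2 := continuousT_comp cX (@continuous_snd I I).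
have cX2' := continuousT_comp cX' (@continuous_snd I I).
split=> [|t|t|s|s]; cbn [fst snd].
- apply: continuous_paste.
  + exact: continuousT_comp (@val_I01_continuous R) (@continuous_fst _ _).
  + by apply: crad => //; exact: continuous_clamp.
  + apply: crad => //; apply: (continuousT_comp reverse_continuous).
    by apply: continuous_clamp; apply: continuousRB => //; exact: cst_continuous.
  + move=> z ->; rewrite mulfV ?pnatr_eq0// subrr -[clamp 0]/zero.
    by rewrite reverse_zero -[clamp 1]/one !radial_one.
- by [].
- by [].
- rewrite I01_val0 invr_ge0 ler0n mulr0 -[clamp 0]/zero radial_zero.
  exact/esym/glue_loop_zero.
- rewrite I01_val1 half_lt1 double1B1 -[clamp 1]/one reverse_one radial_zero.
  exact/esym/glue_loop_one.
Qed.

End flat_section.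

Lemma flat_section_edges (R : realType) (h : nat) (S : topologicalType)
    (q : disk R -> S) (q_param : parametrization h q) (G : topologicalGroupType)
    (b0 : S) (rho : pi1_hom R b0 G) (z0 : disk R) (qz0 : q z0 = b0) (k : nat) :
  let s := flat_section (param_continuous q_param) rho qz0 in
  (k < 4 * h)%N -> (k %% 4 < 2)%N -> exists a : G, forall t, 0 <= t <= 1 ->
    s (boundary h ((k + 2)%:R + (1 - t))) = gact (s (boundary h (k%:R + t))) a.
Proof.
move=> s k4 k2; set cq := param_continuous q_param.
have t00 : 0 <= (0 : R) <= 1 by rewrite lexx ler01.
pose l0 := glue_loop cq qz0 (param_glue q_param k4 k2 t00).
exists (rho l0)^-1%g => t /andP[t0 t1].
(* The pair slides from the start of the side to the parameter [t]. *)
pose X (c : I01 R) := boundary h (k%:R + I01_val c * t).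
pose X' (c : I01 R) := boundary h ((k + 2)%:R + (1 - I01_val c * t)).
have XX' c : q (X c) = q (X' c).
  apply: (param_glue q_param k4 k2); have /andP[c0 c1] := I01_val_itv c.
  by rewrite mulr_ge0//= mulr_ile1.
have ct : continuous (fun c : I01 R => I01_val c * t).
  by apply: continuousRM; [exact: val_I01_continuous|exact: cst_continuous].
have cX : continuous X.
  apply: (continuousT_comp (@boundary_continuous R h)).
  by apply: continuousRD => //; exact: cst_continuous.
have cX' : continuous X'.
  apply: (continuousT_comp (@boundary_continuous R h)).
  by apply: continuousRD; [|apply: continuousRB => //]; exact: cst_continuous.
have -> : rho l0 = rho (glue_loop cq qz0 (XX' one)).
  rewrite -(pi1_homotopic rho (glue_loop_homotopic cq qz0 XX' cX cX')).
  congr (rho _); apply/path_eqP => c.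
  change (glue_loop_fun q z0 (boundary h (k%:R + 0))
    (boundary h ((k + 2)%:R + (1 - 0))) c = glue_loop_fun q z0 (X zero) (X' zero) c).
  by rewrite /X /X' I01_val0 mul0r.
have <- : X one = boundary h (k%:R + t) by rewrite /X I01_val1 mul1r.
have <- : X' one = boundary h ((k + 2)%:R + (1 - t)) by rewrite /X' I01_val1 mul1r.
exact: flat_section_glue.
Qed.

(** * Quasi-morphisms on products of commutators *)

Section quasimorphism.
Context (R : realType) (G : groupType) (mu : G -> R) (D : R).
Hypothesis mu_quasi : forall g h : G, `|mu (g * h)%g - mu g - mu h| <= D.
Hypothesis mu_homogeneous : forall (g : G) (n : int), mu (expgz g n) = n%:~R * mu g.

Lemma quasimorphism1 : mu 1%g = 0.
Proof. by have := mu_homogeneous 1%g 0; rewrite mul0r. Qed.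

Lemma quasimorphismV g : mu g^-1%g = - mu g.
Proof. by have := mu_homogeneous g (-1); rewrite mulN1r. Qed.

Lemma quasimorphismX g n : mu (g ^+ n)%g = n%:R * mu g.
Proof. exact: (mu_homogeneous g n). Qed.

(** Three defects split a commutator into values that cancel in pairs, and a fourth attaches it to
    the preceding product. *)
Lemma quasimorphism_handles n (a b : nat -> G) :
  `|mu (\prod_(0 <= i < n) (a i * (b i)^-1 * (a i)^-1 * b i))%g| <= n%:R * (4 * D).
Proof.
elim: n => [|n IHn]; first by rewrite big_nil quasimorphism1 normr0 mul0r.
rewrite big_nat_recr//=; set P := (\prod_(0 <= i < n) _)%g in IHn *.
have := mu_quasi P (a n * (b n)^-1 * (a n)^-1 * b n)%g.
have := mu_quasi (a n * (b n)^-1 * (a n)^-1)%g (b n).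
have := mu_quasi (a n * (b n)^-1)%g (a n)^-1%g.
have := mu_quasi (a n) (b n)^-1%g.
move: IHn; rewrite !quasimorphismV !ler_norml -natr1.
move=> /andP[? ?] /andP[? ?] /andP[? ?] /andP[? ?] /andP[? ?].
by apply/andP; split; lra.
Qed.

End quasimorphism.

Lemma foliated_obstruction_bound (R : realType) (h : nat) (S : topologicalType)
    (q : disk R -> S) (G Gt : topologicalGroupType) (p : Gt -> G)
    (mu : Gt -> R) (D : R) (E : principal_bundle G S) (s : disk R -> E) C :
  parametrization h q -> (0 < h)%N -> {morph p : x y / (x * y)%g} ->
  covering_map p -> path_connected R [set: Gt] ->
  (forall g k : Gt, `|mu (g * k)%g - mu g - mu k| <= D) ->
  (forall (g : Gt) (n : int), mu (expgz g n) = n%:~R * mu g) ->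
  continuous s -> (forall x, gproj (s x) = q x) -> edge_lift p h s C ->
  admits_foliated_structure R E -> `|mu (obstruction h C)| <= h%:R * (4 * D).
Proof.
move=> q_param h_gt0 pM p_cov Gt_pc mu_q mu_h cs sq sC.
move=> [b0 [rho [f [f' [[cf cf'] [fK f'K] fproj fact]]]]].
have [z0 qz0] := param_surj q_param b0.
have [_ p_surj _] := p_cov.
pose sF := flat_section (param_continuous q_param) rho qz0.
have f'act e g : f' (gact e g) = gact (f' e) g.
  by rewrite -[RHS]fK fact f'K.
have exA k : exists A : Gt, (k < 4 * h)%N -> (k %% 4 < 2)%N ->
    forall t, 0 <= t <= 1 -> sF (boundary h ((k + 2)%:R + (1 - t))) =
      gact (sF (boundary h (k%:R + t))) (p A).
  have [[k4 k2]|nk] := pselect ((k < 4 * h)%N /\ (k %% 4 < 2)%N).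
    have [a aE] := flat_section_edges q_param rho qz0 k4 k2.
    by have [A pA] := p_surj a; exists A => _ _ t t01; rewrite pA; exact: aE.
  by exists 1%g => k4 k2; case: nk.
have [A AE] := choice exA.
(* Constant jumps have constant lifts, which turns each handle word into a commutator. *)
have sFC : edge_lift p h (f' \o sF) (fun k _ => A k).
  split=> [k|k t k4 k2 t01]; first exact: cst_continuous.
  by rewrite /= AE// f'act.
have csF : continuous (f' \o sF).
  by apply: (continuousT_comp cf'); exact: flat_section_continuous.
rewrite (obstruction_unique pM p_cov Gt_pc h_gt0 cs csF _ sC sFC).
  exact: quasimorphism_handles.
by move=> x; rewrite sq /= -fproj f'K flat_section_proj.
Qed.

Theorem theorem7p2 (R : realType) (G : topologicalGroupType)
  (G_pc : path_connected R [set: G])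
  (G_lpc : locally_path_connected R G)
  (G_slsc : semilocally_simply_connected R G)
  (Gt : topologicalGroupType) (p : Gt -> G)
  (p_univ : universal_covering_group R p)
  (h : nat) (h_ge1 : (1 <= h)%N)
  (S : topologicalType) (S_surface : closed_oriented_surface R h S)
  (mu : Gt -> R) (mu_qm : homogeneous_quasimorphism mu)
  (gamma : Gt) (gamma_pi1 : p gamma = 1%g) (mu_gamma : mu gamma != 0) :
  exists E : nat -> principal_bundle G S,
    (forall i, ~ admits_foliated_structure R (E i)) /\
    (forall i j, i <> j -> ~ gspace_iso (E i) (E j)).
Proof.
have [pM p_cov [Gt_pc _]] := p_univ; have [cp _ _] := p_cov.
have [[D mu_q] mu_h] := mu_qm.
have [q q_param] := surface_parametrization S_surface.
have muX := quasimorphismX mu_h gamma.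
have mu0 : 0 < `|mu gamma| by rewrite normr_gt0.
(* Every power of [gamma] beyond the [N]-th has a value of [mu] exceeding the foliated bound. *)
pose N := Num.trunc (`|h%:R * (4 * D)| / `|mu gamma|).
pose word i := (gamma ^+ (N.+1 + i))%g.
have word_large i : h%:R * (4 * D) < `|mu (word i)|.
  rewrite /word muX normrM ger0_norm// (le_lt_trans (ler_norm _))//.
  by rewrite -ltr_pdivrMr// (lt_le_trans (truncnS_gt _))// ler_nat leq_addr.
have exE i : exists E : principal_bundle G S,
    exists (s : disk R -> E) (C : nat -> R -> Gt),
    [/\ continuous s, forall x, gproj (s x) = q x, edge_lift p h s C &
        obstruction h C = word i].
  apply: bundle_with_obstruction => //.
  by rewrite /word (group_homX pM) gamma_pi1 expg1n.
have [E EP] := choice exE; exists E.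
split=> [i fol|i j ij [f [f' [[cf _] _ fproj fact]]]].
  have [s [C [cs sq sC Cw]]] := EP i.
  have := foliated_obstruction_bound q_param h_ge1 pM p_cov Gt_pc mu_q mu_h
    cs sq sC fol.
  by rewrite Cw leNgt word_large.
have [s [C [cs sq sC Cw]]] := EP i; have [s' [C' [cs' sq' sC' Cw']]] := EP j.
(* An isomorphism carries the section of [E i] to one of [E j] with the same jumps, so the
   obstructions would agree; [mu] then separates the powers. *)
have fsC : edge_lift p h (f \o s) C.
  by split=> [|k t k4 k2 t01]; [exact: (proj1 sC)|rewrite /= (proj2 sC)// fact].
have cfs : continuous (f \o s) by exact: continuousT_comp cf cs.
have : word i = word j.
  rewrite -Cw -Cw'.
  apply: (obstruction_unique pM p_cov Gt_pc h_ge1 cfs cs' _ fsC sC').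
  by move=> x; rewrite /= fproj sq sq'.
move=> /(congr1 mu); rewrite /word !muX => /(mulIf mu_gamma)/eqP.
by rewrite eqr_nat eqn_add2l => /eqP.
Qed.
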